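(* Let $N\ge1$ and let $J$ and $\mathcal{G}$ satisfy the assumptions stated in the context. Assume moreover that there exists $\beta>0$ such that $$\mathcal{G}(x,s)\,s\le\beta s\qquad\text{for all }s\in\mathbb{R}\text{ and a.e. }x\in\mathbb{R}^N.$$ Let $u$ be a solution of the Cauchy problem $$\begin{cases} u_t(x,t)=\displaystyle\int_{\mathbb{R}^N}J(x-y)\,u(y;x,t)\,\mathcal{G}(x,u(y;x,t))\,dy & \text{in }\mathbb{R}^N\times(0,\infty),\\ u(x,0)=u_0(x) & \text{in }\mathbb{R}^N,\end{cases}$$ with positive initial datum $u_0\in L^1(\mathbb{R}^N)\cap L^\infty(\mathbb{R}^N)\cap\mathcal{C}(\mathbb{R}^N)$. Then for any $q\in[1,\infty)$ there exists $C=C(J,N,\beta,q)>0$ such that $$\|u(\cdot,t)\|_{L^q(\mathbb{R}^N)}\le C\,\|u_0\|_{L^1(\mathbb{R}^N)}\,t^{-\frac N2\left(1-\frac1q\right)}$$ for $t$ sufficiently large.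
   Context: Notation: $u(y;x,t):=u(y,t)-u(x,t)$. Assumptions on $J$: $J:\mathbb{R}^N\to\mathbb{R}$ is a nonnegative radially symmetric function with $J\in\mathcal{C}_c(\mathbb{R}^N)$, $\int_{\mathbb{R}^N}J(z)\,dz=1$ and $C(J):=\int_{\mathbb{R}^N}J(z)z_N^2\,dz<\infty$. Assumptions on $\mathcal{G}$: $\mathcal{G}:\mathbb{R}^N\times\mathbb{R}\to\mathbb{R}$ is a nonnegative Carathéodory function ($\mathcal{G}(\cdot,s)$ measurable for every $s\in\mathbb{R}$, $\mathcal{G}(x,\cdot)$ continuous for a.e. $x\in\mathbb{R}^N$) and there exist constants $\alpha_2\ge\alpha_1>0$ such that $$\alpha_1\le\frac{\mathcal{G}(x,s)s-\mathcal{G}(x,\sigma)\sigma}{s-\sigma}\le\alpha_2\qquad\text{for all } s,\sigma\in\mathbb{R},\ s\neq\sigma,\ \text{and a.e. }x\in\mathbb{R}^N.$$ Solution of the Cauchy problem: a function $u\in\mathcal{C}([0,\infty);\mathcal{C}(\mathbb{R}^N))$ satisfying $u(x,t)=\int_0^t\int_{\mathbb{R}^N}J(x-y)u(y;x,\tau)\mathcal{G}(x,u(y;x,\tau))\,dy\,d\tau+u_0(x)$ in $\mathbb{R}^N\times(0,\infty)$. *)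

(* Defs.v *)
From HB Require Import structures.
From mathcomp Require Import all_boot all_order all_algebra.
From mathcomp Require Import all_classical all_reals all_analysis.

Set Implicit Arguments.
Unset Strict Implicit.
Unset Printing Implicit Defensive.

Import Order.TTheory GRing.Theory Num.Theory.
Import numFieldNormedType.Exports.

Local Open Scope classical_set_scope.
Local Open Scope ring_scope.

Fact rV_display : measure_display. Proof. exact: default_measure_display. Qed.

(* The product sigma-algebra, i.e. the one generated by the coordinate maps;
   on R^n it coincides with the Borel sigma-algebra. *)
Section rV_measurable.
Context {R : realType} {n : nat}.

Definition rV_coord (i : 'I_n) (x : 'rV[R]_n) : R := x ord0 i.

Let rV_set0 : g_sigma_preimage rV_coord set0.
Proof. exact: sigma_algebra0. Qed.

Let rV_setC A : g_sigma_preimage rV_coord A -> g_sigma_preimage rV_coord (~` A).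
Proof. exact: sigma_algebraC. Qed.

Let rV_bigcup (F : _^nat) : (forall i, g_sigma_preimage rV_coord (F i)) ->
  g_sigma_preimage rV_coord (\bigcup_i (F i)).
Proof. exact: sigma_algebra_bigcup. Qed.

HB.instance Definition _ := @isMeasurable.Build rV_display
  'rV[R]_n (g_sigma_preimage rV_coord) rV_set0 rV_setC rV_bigcup.

End rV_measurable.

Lemma measurable_rV_coord (R : realType) (n : nat) (i : 'I_n) :
  measurable_fun [set: 'rV[R]_n] (fun x : 'rV[R]_n => x ord0 i).
Proof.
move=> _ Y mY; rewrite setTI; apply: sub_sigma_algebra => /=.
rewrite -bigcup_seq/=; exists i => /=; first by rewrite mem_index_enum.
by exists Y => //; rewrite setTI.
Qed.

Lemma measurable_to_rV d (T : measurableType d) (R : realType) (n : nat)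
    (f : T -> 'rV[R]_n) :
  (forall i, measurable_fun [set: T] (fun x => f x ord0 i)) ->
  measurable_fun [set: T] f.
Proof.
move=> mf.
suff : g_sigma_preimage (fun i => rV_coord i \o f) `<=` measurable.
  by rewrite g_sigma_preimage_comp => pf _ A mA; apply: pf; exists A.
apply: smallest_sub; first exact: sigma_algebra_measurable.
case: n => [|n] in f mf *; first by rewrite big_ord0.
rewrite -bigcup_mkord_ord; apply: bigcup_sub => i Ii.
by move=> A [B mB <-]; exact: mf.
Qed.

Definition rV_cons {R : realType} {n : nat} (p : 'rV[R]_n * R) : 'rV[R]_n.+1 :=
  row_mx (const_mx p.2 : 'rV_1) p.1.

Lemma measurable_rV_cons (R : realType) (n : nat) :
  measurable_fun [set: 'rV[R]_n * R] (@rV_cons R n).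
Proof.
apply: measurable_to_rV => i; case: (@split_ordP 1 n i) => j ->.
  rewrite (_ : (fun _ => _) = snd)//; apply/funext => p /=.
  by rewrite /rV_cons (@row_mxEl _ _ 1) mxE.
rewrite (_ : (fun _ => _) = (fun x : 'rV_n => x ord0 j) \o fst); last first.
  by apply/funext => p /=; rewrite /rV_cons (@row_mxEr _ _ 1).
exact: (measurableT_comp (measurable_rV_coord j)).
Qed.

Definition lebesgue_rV_succ (R : realType) (n : nat)
  (mu : {measure set 'rV[R]_n -> \bar R}) :
  {measure set 'rV[R]_n.+1 -> \bar R}.
Proof.
refine [the {measure set _ -> \bar R} of
  pushforward (mu \x (@lebesgue_measure R))%E (@rV_cons R n)].
exact: measurable_rV_cons.
Defined.

Fixpoint lebesgue_rV (R : realType) (n : nat) :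
    {measure set 'rV[R]_n -> \bar R} :=
  if n is m.+1 then lebesgue_rV_succ (lebesgue_rV R m)
  else [the {measure set _ -> \bar R} of dirac (0 : 'rV[R]_0)].

(* The library's norm on ['rV[R]_n] is the sup norm, hence this one. *)
Definition euclidean_norm {R : realType} {n : nat} (x : 'rV[R]_n) : R :=
  Num.sqrt (\sum_(i < n) x ord0 i ^+ 2).

Definition radially_symmetric {R : realType} {n : nat} (f : 'rV[R]_n -> R) :=
  forall x y, euclidean_norm x = euclidean_norm y -> f x = f y.

Definition compactly_supported {R : realType} {n : nat} (f : 'rV[R]_n -> R) :=
  compact (closure [set x | f x != 0]).

(* Measurability with respect to the Lebesgue sigma-algebra (the Caratheodory
   sets of the outer Lebesgue measure), not only the Borel one. *)
Definition lebesgue_measurable_fun {R : realType} {n : nat}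
    (f : 'rV[R]_n -> R) :=
  measurable_fun [set: caratheodory_type ((lebesgue_rV R n)^*)%mu] f.

(* Space dimension [N = n.+1]; [z_N] is the last coordinate of [z]. *)
Record kernel_hyp {R : realType} {n : nat} (J : 'rV[R]_n.+1 -> R) : Prop := {
  kernel_ge0 : forall z, 0 <= J z ;
  kernel_radial : radially_symmetric J ;
  kernel_continuous : continuous J ;
  kernel_supp : compactly_supported J ;
  kernel_mass : (\int[lebesgue_rV R n.+1]_z (J z)%:E = 1)%E ;
  kernel_moment :
    (\int[lebesgue_rV R n.+1]_z (J z * z ord0 ord_max ^+ 2)%:E < +oo)%E }.

Definition caratheodory_fun {R : realType} {n : nat} (G : 'rV[R]_n -> R -> R) :=
  (forall s, lebesgue_measurable_fun (G ^~ s)) /\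
  {ae lebesgue_rV R n, forall x, continuous (G x)}.

Record conductivity_hyp {R : realType} {n : nat} (G : 'rV[R]_n -> R -> R) :
    Prop := {
  conductivity_ge0 : forall x s, 0 <= G x s ;
  conductivity_caratheodory : caratheodory_fun G ;
  conductivity_bounds : exists alpha1 alpha2 : R,
    [/\ 0 < alpha1, alpha1 <= alpha2 &
      forall s sigma : R, s != sigma ->
        {ae lebesgue_rV R n, forall x,
          alpha1 <= (G x s * s - G x sigma * sigma) / (s - sigma) <= alpha2}] }.

(* [increment u x t y] is [u(y;x,t) = u(y,t) - u(x,t)]. Time comes first:
   [u t] is the profile of [u] at time [t]. *)
Definition increment {R : realType} {n : nat} (u : R -> 'rV[R]_n -> R)
    (x : 'rV[R]_n) (t : R) (y : 'rV[R]_n) : R :=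
  u t y - u t x.

(* [u \in C([0, oo); C(R^n))], where [C(R^n)] carries the topology of uniform
   convergence. *)
Definition continuous_evolution {R : realType} {n : nat}
    (u : R -> 'rV[R]_n -> R) :=
  (forall t, 0 <= t -> continuous (u t)) /\
  {within [set t | 0 <= t],
    continuous (u : R -> {uniform 'rV[R]_n -> R})}.

(* The initial condition [u 0 = u0] is the limit [t --> 0] of the integral
   equation. *)
Definition cauchy_solution {R : realType} {n : nat} (J : 'rV[R]_n -> R)
    (G : 'rV[R]_n -> R -> R) (u0 : 'rV[R]_n -> R) (u : R -> 'rV[R]_n -> R) :=
  continuous_evolution u /\
  forall x t, 0 < t ->
    u t x = \int[@lebesgue_measure R]_(tau in `[0, t])
              \int[lebesgue_rV R n]_y
                (J (x - y) * increment u x tau y * G x (increment u x tau y))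
            + u0 x.

(* Main.v *)
Require Import Defs.
From HB Require Import structures.
From mathcomp Require Import all_boot all_order all_algebra.
From mathcomp Require Import all_classical all_reals all_analysis.
From mathcomp Require Import ess_sup_inf measurable_realfun.
From mathcomp Require Import ring lra zify.

Set Implicit Arguments.
Unset Strict Implicit.
Unset Printing Implicit Defensive.

Import Order.TTheory GRing.Theory Num.Theory.
Import numFieldNormedType.Exports.

Local Open Scope classical_set_scope.
Local Open Scope ring_scope.

(** Nonnegativity of [G] and [G(x,s)s <= beta s] make [u] a nonnegative
subsolution of the linear equation [v_t = beta (J * v - v)], so that
[u(t) <= e^{-beta t} sum_k (beta t)^k / k! J^{*k} * u0].  Every [J^{*k}]
preserves the integral, which settles [q = 1]; the other exponents follow by
interpolation from the bound [C t^{-N/2} ||u0||_1] on the supremum of the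
series, plus a term decaying exponentially.

For that bound no Fourier analysis is needed.  Since [J] is continuous, it
dominates [c] times the indicator of a cube of side [2h], so a step of the
random walk with density [J] is, with probability [e > 0], uniform on this
cube.  A uniform point of a cube of side [2h] is a uniform point of a cube of
side [h] shifted by a fair choice of [0] or [h] in each coordinate; after [j]
such steps each coordinate of the total shift is binomial and takes any given
value with probability at most [C / sqrt j], while the [h]-cubes shifted by the
lattice tile the space.
Hence [j] uniform steps have a density at most [C j^{-N/2}], and averaging over
the number [j] of uniform steps, which is Poisson of parameter [e beta t],
gives [C t^{-N/2}]. *)

(** * Lebesgue measure on row vectors *)

Section rV_measure.
Context {R : realType}.

(** The hypotheses on [G] are usable only at almost every [x], with a null set that may depend on
    [s]. The time evolution is therefore studied at one good [x] at a time, and each inequality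
    obtained is carried to all points by continuity of [u t]: a closed set of full measure is the
    whole space. Comparison with the linear equation is an induction on the order of the truncated
    exponential series, with a remainder tending to [0]. Nonnegativity of [u] is proved before it,
    so that averages of [u t] are integrals in the extended reals to which Tonelli applies. Binomial
    smoothing yields the power [i^(-N/2)] of the number [i] of uniform steps, whose binomial and
    Poisson means have no closed form. With [x = beta t] and [th = x^(N/2)], the inequality
    [v <= th v^2 + th^-1] trades it for [i^(-N)], comparable to a ratio of factorials whose means
    can be summed; the order of magnitude survives because [i] is typically of order [x]. The
    exponentially small term carries the supremum of [u0], not its mass. It is absorbed for large
    [t] only: the threshold depends on [u0], the constant does not. *)

Lemma rV_cons0 n (p : 'rV[R]_n * R) : rV_cons p ord0 ord0 = p.2.
Proof.
rewrite /rV_cons (_ : ord0 = lshift n ord0 :> 'I_(1 + n)) ?(@row_mxEl _ 1 1) ?mxE//.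
exact: val_inj.
Qed.

Lemma rV_consS n (p : 'rV[R]_n * R) i : rV_cons p ord0 (lift ord0 i) = p.1 ord0 i.
Proof. by rewrite /rV_cons -rshift1 (@row_mxEr _ _ 1). Qed.

(** Half-open, so that cutting a side gives a disjoint union of two boxes and translated cubes tile
    exactly. *)
Definition box n (a b : 'I_n -> R) : set 'rV[R]_n :=
  [set z | forall i, a i <= z ord0 i < b i].

Lemma boxE n (a b : 'I_n -> R) :
  box a b = \bigcap_(i in [set: 'I_n])
    ((fun z : 'rV[R]_n => z ord0 i) @^-1` `[a i, b i[%classic).
Proof.
apply/seteqP; split=> z /= h i; first by move=> _; rewrite /= in_itv/=; exact: h.
by have := h i I; rewrite /= in_itv.
Qed.

Lemma measurable_box n (a b : 'I_n -> R) : measurable (box a b).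
Proof.
rewrite boxE; apply: fin_bigcap_measurable => [|i _]; first exact: finite_finset.
by rewrite -[X in measurable X]setTI; apply: measurable_rV_coord.
Qed.

Lemma preimage_rV_cons_box n (a b : 'I_n.+1 -> R) :
  @rV_cons R n @^-1` box a b =
  box (a \o lift ord0) (b \o lift ord0) `*` `[a ord0, b ord0[%classic.
Proof.
apply/seteqP; split=> [[p r] h|[p r] /= [h1 h2] i].
  split=> [i|] /=.
    by have := h (lift ord0 i); rewrite rV_consS.
  by have := h ord0; rewrite rV_cons0 in_itv.
have [j ->|->] := unliftP ord0 i; first by rewrite rV_consS; exact: h1.
by rewrite rV_cons0; move: h2; rewrite in_itv.
Qed.

Lemma lebesgue_rV_box n (a b : 'I_n -> R) : (forall i, a i <= b i) ->
  lebesgue_rV R n (box a b) = (\prod_i (b i - a i))%:E.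
Proof.
elim: n a b => [|n ih] a b ab.
  rewrite big_ord0 /= diracE (_ : _ \in _ = true)//.
  by apply/mem_set; case.
rewrite /= /pushforward preimage_rV_cons_box product_measure1E//; last exact: measurable_box.
rewrite ih => [|i]; last exact: ab.
rewrite big_ord_recl/= mulrC EFinM; congr (_ * _)%E.
by rewrite lebesgue_measure_itv/= lte_fin; case: ltP => // ba; congr EFin;
  apply/eqP; rewrite eq_sym subr_eq0 eq_le ba ab.
Qed.

Lemma coord_le_norm n (z : 'rV[R]_n) i : `|z ord0 i| <= `|z|.
Proof. by rewrite [leRHS]mx_normrE; apply: (le_bigmax _ (fun k => `|z k.1 k.2|) (ord0, i)). Qed.

Lemma lebesgue_rV_sigma_finite n : sigma_finite setT (lebesgue_rV R n).
Proof.
exists (fun k => box (fun=> - k%:R) (fun=> k%:R)) => [|k]; last first.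
  split; first exact: measurable_box.
  rewrite lebesgue_rV_box ?ltry// => i.
  by rewrite (@le_trans _ _ 0)// oppr_le0.
apply/seteqP; split=> // z _.
exists (Num.truncn `|z|).+1 => // i.
have : `|z ord0 i| < (Num.truncn `|z|).+1%:R.
  exact: le_lt_trans (coord_le_norm z i) (truncnS_gt _).
by rewrite ltr_norml => /andP[/ltW -> ->].
Qed.

(* A constant wrapping [lebesgue_rV], to which the sigma-finite structure can be attached. *)
Definition leb n : set 'rV[R]_n -> \bar R := lebesgue_rV R n.
Arguments leb : clear implicits.
HB.instance Definition _ n := Measure.copy (leb n) (lebesgue_rV R n).
HB.instance Definition _ n :=
  Measure_isSigmaFinite.Build _ _ _ (leb n) (lebesgue_rV_sigma_finite n).

Lemma lebesgue_measure_translate (a : R) (f : measurableTypeR R -> \bar R) :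
  measurable_fun setT f -> (forall x, 0 <= f x)%E ->
  (\int[lebesgue_measure]_r f (a + r)%R = \int[lebesgue_measure]_r f r)%E.
Proof.
move=> mf f0.
pose sh (r : measurableTypeR R) : measurableTypeR R := a + r.
have ma : measurable_fun [set: measurableTypeR R] sh.
  exact: measurable_funD.
rewrite -[LHS](ge0_integral_pushforward ma (@lebesgue_measure R) measurableT mf)//.
apply: eq_measure_integral => A mA _; apply/esym.
apply: (@lebesgue_measure_unique _ (pushforward lebesgue_measure sh)) => //.
move=> X [[x y] /= xy <-].
rewrite /pushforward (_ : _ @^-1` _ = `]x - a, y - a]%classic).
  by rewrite !lebesgue_measure_itv/= !lte_fin ltrD2r; case: ifP => // _;
   rewrite -!EFinD; congr EFin; ring.
by apply/seteqP; split=> r /=; rewrite !in_itv/= ltrBlDl lerBrDl.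
Qed.

Lemma measurable_rV_shift n (x : 'rV[R]_n) : measurable_fun [set: 'rV[R]_n] (fun z => x + z).
Proof.
apply: measurable_to_rV => i; under eq_fun do rewrite mxE.
by apply: measurable_funD => //; exact: measurable_rV_coord.
Qed.

Lemma rV_consD n (p q : 'rV[R]_n * R) : rV_cons p + rV_cons q = rV_cons (p.1 + q.1, p.2 + q.2).
Proof.
apply/rowP => i; rewrite mxE.
by have [j ->|->] := unliftP ord0 i; rewrite ?rV_consS ?rV_cons0//= mxE.
Qed.

Lemma rV_cons_surj n (x : 'rV[R]_n.+1) : exists p, x = rV_cons p.
Proof.
exists (\row_i x ord0 (lift ord0 i), x ord0 ord0); apply/rowP => i.
by have [j ->|->] := unliftP ord0 i; rewrite ?rV_consS ?rV_cons0//= mxE.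
Qed.

Lemma measurable_rV_consR n :
  measurable_fun [set: 'rV[R]_n * measurableTypeR R] (@rV_cons R n).
Proof. exact: measurable_rV_cons. Qed.

Lemma integral_leb_succ n (f : 'rV[R]_n.+1 -> \bar R) :
  measurable_fun setT f -> (forall x, 0 <= f x)%E ->
  (\int[leb n.+1]_z f z = \int[leb n]_p \int[lebesgue_measure]_r f (rV_cons (p, r)))%E.
Proof.
move=> mf f0.
have -> : (\int[leb n.+1]_z f z = \int[leb n \x lebesgue_measure]_z (f \o @rV_cons R n) z)%E.
  exact: (ge0_integral_pushforward (@measurable_rV_consR n)
           (leb n \x @lebesgue_measure R)%E measurableT mf).
rewrite fubini_tonelli1// => [|x]; last exact: f0.
by apply: measurableT_comp => //; exact: measurable_rV_consR.
Qed.

(** Tonelli peels off the first coordinate: the one-dimensional integral absorbs its shift [a], the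
    induction hypothesis the shift [y] of the others. *)
Lemma integral_leb_translate n (x : 'rV[R]_n) (f : 'rV[R]_n -> \bar R) :
  measurable_fun setT f -> (forall x, 0 <= f x)%E ->
  (\int[leb n]_z f (x + z)%R = \int[leb n]_z f z)%E.
Proof.
elim: n x f => [|n ih] x f mf f0.
  by apply: eq_integral => z _; congr f; apply/rowP; case.
have mfx : measurable_fun setT (fun z => f (x + z)).
  by apply: measurableT_comp => //; exact: measurable_rV_shift.
have [[y a] xE] := rV_cons_surj x.
have mfc : measurable_fun setT (f \o @rV_cons R n).
  by apply: measurableT_comp => //; exact: measurable_rV_consR.
have mfr (p : 'rV[R]_n) : measurable_fun [set: measurableTypeR R] (fun r => f (rV_cons (p, r))).
  exact: (measurableT_comp mfc (pair1_measurable p)).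
rewrite (integral_leb_succ mf f0) (integral_leb_succ mfx (fun z => f0 _)).
transitivity (\int[leb n]_p \int[lebesgue_measure]_r f (rV_cons (y + p, r)%R))%E.
  apply: eq_integral => p _.
  rewrite -(lebesgue_measure_translate a (mfr _)) => [|//].
  by apply: eq_integral => r _; rewrite xE rV_consD.
rewrite (ih y (fun p => \int[lebesgue_measure]_r f (rV_cons (p, r)))%E) => [//| |p].
  apply: (@measurable_fun_fubini_tonelli_F _ _ _ _ _ lebesgue_measure (f \o @rV_cons R n)).
  - exact: mfc.
  - by move=> x'; exact: f0.
by apply: integral_ge0 => r _; exact: f0.
Qed.

(** The sigma-algebra comes from the coordinates, not from the topology, so an open set is written
    as a countable union of boxes with rational centres. *)
Lemma open_measurable_rV n (U : set 'rV[R]_n) : open U -> measurable U.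
Proof.
move=> oU.
pose B (p : 'rV[rat]_n * nat) : set 'rV[R]_n :=
  box (fun i => ratr (p.1 ord0 i) - p.2.+1%:R^-1) (fun i => ratr (p.1 ord0 i) + p.2.+1%:R^-1).
rewrite (_ : U = \bigcup_p (if `[< B p `<=` U >] then B p else set0)).
  apply: countable_bigcupT_measurable => [|p]; first exact: countableP.
  by case: ifP => _ //; exact: measurable_box.
apply/seteqP; split=> [z Uz|z [p _]]; last by case: asboolP => // BU /BU.
have /nbhs_ballP[e /= e0 zeU] : nbhs z U by exact: open_nbhs_nbhs.
(* Both [z] and any other point of the box lie within [1/(k+1)] of its centre, hence the half. *)
have [k _ ke] : exists2 k : nat, True & k.+1%:R^-1 < e / 2.
  exists (Num.truncn (e / 2)^-1) => //.
  by rewrite invf_plt ?posrE ?divr_gt0// truncnS_gt.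
have /choice[q qz] i : exists q : rat, z ord0 i - k.+1%:R^-1 < ratr q < z ord0 i + k.+1%:R^-1.
  have : z ord0 i - k.+1%:R^-1 < z ord0 i + k.+1%:R^-1 by rewrite ltrD2l gtrN// invr_gt0.
  by move=> /rat_in_itvoo[q]; rewrite in_itv => qz; exists q.
exists (\row_i q i, k) => //; case: asboolP => [_ i|[]].
  by have /andP[h1 h2] := qz i; rewrite /= mxE lerBlDr (ltW h2) -ltrBlDr.
move=> w Bw; apply: zeU; split=> // i j; rewrite [i]ord1.
have := Bw j; rewrite /ball/= mxE => /andP[]; have /andP[] := qz j; rewrite ltr_distl.
move: (ratr (q j)) (k.+1%:R^-1) ke => q1 k1 ? ? ? ? ?.
by apply/andP; split; lra.
Qed.

Lemma continuous_measurable_rV n (f : 'rV[R]_n -> R) :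
  continuous f -> measurable_fun setT f.
Proof.
move=> cf; apply: (measurability _ (RGenOpens.measurableE R)).
move=> _ [_ [a [b ->] <-]]; rewrite setTI; apply: open_measurable_rV.
by apply: open_comp => //; exact: interval_open.
Qed.

End rV_measure.
Arguments leb : clear implicits.

(** * Correlation with a nonnegative kernel *)

Section correlation.
Context {R : realType} {n : nat}.
Implicit Types (k : 'rV[R]_n -> R) (f g : 'rV[R]_n -> \bar R).
Local Open Scope ereal_scope.

Definition nnmeas f := measurable_fun setT f /\ forall x, 0 <= f x.

Definition nnker k := measurable_fun setT k /\ forall x, (0 <= k x)%R.

(** Correlation rather than convolution: changes of variables then involve no reflection, and for
    the symmetric [J] the two coincide. Values in [\bar R] make Tonelli available without
    integrability. *)
Definition corr k f : 'rV[R]_n -> \bar R :=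
  fun x => \int[leb R n]_z ((k z)%:E * f (x + z)%R).

Definition translate (b : 'rV[R]_n) f : 'rV[R]_n -> \bar R := fun x => f (b + x)%R.

Lemma measurable_rV_add :
  measurable_fun [set: 'rV[R]_n * 'rV[R]_n] (fun p => (p.1 + p.2)%R).
Proof.
apply: measurable_to_rV => i; under eq_fun do rewrite mxE.
by apply: measurable_funD;
  [exact: (measurableT_comp (measurable_rV_coord i) measurable_fst)
  |exact: (measurableT_comp (measurable_rV_coord i) measurable_snd)].
Qed.

Lemma nnmeas_translate b f : nnmeas f -> nnmeas (translate b f).
Proof.
move=> [mf f0]; split=> [|x]; last exact: f0.
by apply: (measurableT_comp mf); exact: measurable_rV_shift.
Qed.

Lemma nnmeas_kerM k f : nnker k -> nnmeas f -> nnmeas (fun z => (k z)%:E * f z).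
Proof.
move=> [mk k0] [mf f0]; split=> [|x]; last by rewrite mule_ge0// lee_fin.
by apply: emeasurable_funM => //; exact/measurable_EFinP.
Qed.

Lemma nnmeas_corr_integrand k f x :
  nnker k -> nnmeas f -> nnmeas (fun z => (k z)%:E * f (x + z)%R).
Proof. by move=> hk /(nnmeas_translate x) hf; exact: nnmeas_kerM. Qed.

Lemma nnmeas_integral f : nnmeas f -> 0 <= \int[leb R n]_z f z.
Proof. by move=> [_ f0]; exact: integral_ge0. Qed.

Lemma measurable_corr_integrand k f : nnker k -> nnmeas f ->
  measurable_fun [set: 'rV[R]_n * 'rV[R]_n] (fun p => (k p.2)%:E * f (p.1 + p.2)%R).
Proof.
move=> [mk k0] [mf f0]; apply: emeasurable_funM.
  by apply/measurable_EFinP; exact: (measurableT_comp mk measurable_snd).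
exact: (measurableT_comp mf measurable_rV_add).
Qed.

Lemma nnmeas_corr k f : nnker k -> nnmeas f -> nnmeas (corr k f).
Proof.
move=> hk hf; split=> [|x]; last exact: (nnmeas_integral (nnmeas_corr_integrand x hk hf)).
apply: (@measurable_fun_fubini_tonelli_F _ _ _ _ _ (leb R n) _ (measurable_corr_integrand hk hf)).
by move=> p; case: hk hf => [_ k0] [_ f0]; rewrite mule_ge0// lee_fin.
Qed.

Lemma corr_kerD k1 k2 f x : nnker k1 -> nnker k2 -> nnmeas f ->
  corr (fun z => k1 z + k2 z)%R f x = corr k1 f x + corr k2 f x.
Proof.
move=> h1 h2 hf.
have [m1 p1] := nnmeas_corr_integrand x h1 hf.
have [m2 p2] := nnmeas_corr_integrand x h2 hf.
rewrite /corr -ge0_integralD//; apply: eq_integral => z _.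
by rewrite EFinD ge0_muleDl// lee_fin; [exact: h1.2|exact: h2.2].
Qed.

Lemma corr_sum k (I : Type) (s : seq I) (F : I -> 'rV[R]_n -> \bar R) x :
  nnker k -> (forall i, nnmeas (F i)) ->
  corr k (fun y => \sum_(i <- s) F i y) x = \sum_(i <- s) corr k (F i) x.
Proof.
move=> hk hF; rewrite /corr.
rewrite -ge0_integral_sum//=; last 2 first.
- by move=> i; have [] := nnmeas_corr_integrand x hk (hF i).
- by move=> i z _; have [_] := nnmeas_corr_integrand x hk (hF i).
apply: eq_integral => z _; rewrite ge0_sume_distrr// => i _.
by have [] := hF i.
Qed.

Lemma corrZ k (c : R) f x : nnker k -> nnmeas f -> (0 <= c)%R ->
  corr k (fun y => c%:E * f y) x = c%:E * corr k f x.
Proof.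
move=> hk hf c0; have [m p] := nnmeas_corr_integrand x hk hf.
rewrite /corr -ge0_integralZl_EFin//; apply: eq_integral => z _.
by rewrite muleCA.
Qed.

Lemma corr_translate k b f x : corr k (translate b f) x = corr k f (b + x).
Proof. by apply: eq_integral => z _; rewrite /translate addrA. Qed.

Lemma corr_le_cst k f (M : R) x : nnker k -> nnmeas f -> (0 <= M)%R ->
  (forall y, f y <= M%:E) -> corr k f x <= M%:E * \int[leb R n]_z (k z)%:E.
Proof.
move=> hk hf M0 fM.
rewrite -ge0_integralZl_EFin//; [|by move=> z _; rewrite lee_fin; exact: hk.2
  |by apply/measurable_EFinP; exact: hk.1].
have [mf pf] := nnmeas_corr_integrand x hk hf.
apply: ge0_le_integral => //.
- by apply: emeasurable_funM => //; apply/measurable_EFinP; exact: hk.1.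
by move=> z _; rewrite muleC lee_wpmul2r// lee_fin; exact: hk.2.
Qed.

Lemma integral_corr k f : nnker k -> nnmeas f ->
  \int[leb R n]_x corr k f x = (\int[leb R n]_z (k z)%:E) * \int[leb R n]_z f z.
Proof.
move=> hk hf.
rewrite (fubini_tonelli _ (measurable_corr_integrand hk hf)) => [|p]; last first.
  by rewrite mule_ge0 ?lee_fin; [|exact: hk.2|exact: hf.2].
rewrite -ge0_integralZr//; last 3 first.
- by apply/measurable_EFinP; exact: hk.1.
- by move=> z _; rewrite lee_fin; exact: hk.2.
- exact: nnmeas_integral.
apply: eq_integral => z _ /=.
rewrite ge0_integralZl_EFin//; last 3 first.
- by move=> y _; exact: hf.2.
- have [+ _] := nnmeas_translate z hf.
  by rewrite (_ : translate z f = fun y => f (y + z)%R)//; apply/funext => y; rewrite /translate addrC.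
- exact: hk.2.
congr (_ * _).
rewrite -[RHS](integral_leb_translate z hf.1 hf.2).
by apply: eq_integral => y _; rewrite addrC.
Qed.

Lemma corrC k1 k2 f x : nnker k1 -> nnker k2 -> nnmeas f ->
  corr k1 (corr k2 f) x = corr k2 (corr k1 f) x.
Proof.
move=> h1 h2 hf.
have E : forall h h' z, nnker h -> nnker h' ->
   (h z)%:E * corr h' f (x + z) = \int[leb R n]_y ((h z)%:E * ((h' y)%:E * f (x + z + y)%R)).
  move=> h h' z hh hh'; have [m p] := nnmeas_corr_integrand (x + z) hh' hf.
  by rewrite ge0_integralZl_EFin//; exact: hh.2.
under [LHS]eq_integral => z _ do rewrite E//.
under [RHS]eq_integral => z _ do rewrite E//.
rewrite (fubini_tonelli (fun p => (k1 p.1)%:E * ((k2 p.2)%:E * f (x + p.1 + p.2)%R)))/=.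
- apply: eq_integral => y _; apply: eq_integral => z _.
  by rewrite muleCA -!addrA (addrC z).
- apply: emeasurable_funM.
    by apply/measurable_EFinP; exact: (measurableT_comp h1.1 measurable_fst).
  under eq_fun do rewrite -addrA.
  exact: (@measurable_corr_integrand k2 (translate x f) h2 (nnmeas_translate x hf)).
- by move=> p; rewrite mule_ge0 ?mule_ge0 ?lee_fin ?h1.2 ?h2.2 ?hf.2.
Qed.

End correlation.

(** * Bounds on binomial coefficients *)

Section binomials.

Lemma bin_le_bin_half m b : ('C(m.*2, b) <= 'C(m.*2, m))%N.
Proof.
have up b' : (b' < m)%N -> ('C(m.*2, b') <= 'C(m.*2, b'.+1))%N.
  move=> bm; rewrite -(leq_pmul2l (ltn0Sn b')) mul_bin_left leq_mul2r; apply/orP; right.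
  by lia.
have le_low b' : (b' <= m)%N -> ('C(m.*2, b') <= 'C(m.*2, m))%N.
  move=> bm; have [k km ->] : exists2 k, (k <= m)%N & b' = (m - k)%N by exists (m - b')%N; lia.
  elim: k km => [|k ih] km; first by rewrite subn0.
  apply: leq_trans (ih (ltnW km)); rewrite (_ : m - k = (m - k.+1).+1)%N; last lia.
  by apply: up; lia.
have [bm|mb] := leqP b m; first exact: le_low.
have [bm2|] := leqP b m.*2; last by move=> h; rewrite bin_small.
by rewrite -bin_sub// le_low//; lia.
Qed.

(** This is ['C(2m, m) <= 4^m / sqrt (2m + 1)], squared to stay among integers; the induction closes
    because [(2m + 1)(2m + 3) <= (2m + 2)^2]. *)
Lemma sqr_central_bin m : ('C(m.*2, m) ^ 2 * m.*2.+1 <= 16 ^ m)%N.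
Proof.
elim: m => [|m ih] //.
have E : (m.+1 * 'C(m.+1.*2, m.+1) = 2 * m.*2.+1 * 'C(m.*2, m))%N.
  have h1 := mul_bin_diag m.+1.*2.-1 m; have h2 := mul_bin_left m.*2.+1 m.
  have h3 := mul_bin_diag m.*2 m.
  have h4 : 'C(m.*2.+1, m.+1) = 'C(m.*2.+1, m).
    by rewrite -bin_sub; [congr 'C(_, _); lia|lia].
  move: h1 h3; rewrite doubleS /= h4 => h1 h3.
  have h5 : 'C(m.*2.+2, m.+1) = (2 * 'C(m.*2.+1, m))%N by rewrite binS h4 mul2n addnn.
  rewrite h5; nia.
have : (m.+1 ^ 2 * ('C(m.+1.*2, m.+1) ^ 2 * m.+1.*2.+1) <= m.+1 ^ 2 * 16 ^ m.+1)%N.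
  rewrite mulnA -expnMn E expnMn.
  have : (4 * m.*2.+1 * (m.*2.+3) <= 16 * m.+1 ^ 2)%N by nia.
  move: ih; set c := 'C(_, _); rewrite (expnS 16) doubleS; set d := (16 ^ m)%N => h1 h2.
  have := leq_mul h1 h2; move: m.*2.+1 m.*2.+3 m.+1 => a e f.
  rewrite (_ : c ^ 2 * a * _ = (2 * a) ^ 2 * c ^ 2 * e)%N; last ring.
  by rewrite (_ : d * _ = f ^ 2 * (16 * d))%N//; ring.
by rewrite leq_pmul2l// expn_gt0.
Qed.

(** The factor [2] pays for the odd rows, where an entry is the sum of two entries of the even row
    above and [2m + 2 <= 2 (2m + 1)]. *)
Lemma sqr_bin_le j b : ('C(j, b) ^ 2 * j.+1 <= 2 * 4 ^ j)%N.
Proof.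
have even m b' : ('C(m.*2, b') ^ 2 * m.*2.+1 <= 4 ^ m.*2)%N.
  rewrite -mul2n expnM mul2n; apply: leq_trans (sqr_central_bin m).
  by rewrite leq_mul2r leq_exp2r// bin_le_bin_half orbT.
have /eqP := odd_double_half j; set m := j./2; case: (odd j) => /= /eqP <-; last first.
  by rewrite add0n; apply: leq_trans (even _ _) _; rewrite leq_pmull.
rewrite add1n; case: b => [|b].
  rewrite bin0 exp1n mul1n expnS; have := @ltn_expl 4 m.*2 isT; lia.
have h1 := even m b; have h2 := even m b.+1.
have -> : ('C(m.*2.+1, b.+1) = 'C(m.*2, b.+1) + 'C(m.*2, b))%N by rewrite binS.
rewrite (expnS 4); move: h1 h2; move: 'C(_, b) 'C(_, b.+1) (4 ^ _)%N => c c' d h1 h2.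
have h3 : ((c' + c) ^ 2 <= 2 * (c ^ 2 + c' ^ 2))%N.
  by rewrite sqrnD; have [+ _] := nat_Cauchy c' c; lia.
apply: (leq_trans (leq_mul h3 (leqnn _))).
by apply: (@leq_trans (2 * (c ^ 2 + c' ^ 2) * (2 * m.*2.+1))%N); nia.
Qed.

End binomials.

(** * Uniform steps on a cube *)

Section box_average.
Context {R : realType} {n : nat}.
Implicit Types (k : 'rV[R]_n -> R) (f g : 'rV[R]_n -> \bar R) (s : 'I_n -> R).
Local Open Scope ereal_scope.

Definition box_corr s : ('rV[R]_n -> \bar R) -> 'rV[R]_n -> \bar R :=
  corr \1_(box (fun=> 0%R) s).

Definition set_coord s (i : 'I_n) (v : R) : 'I_n -> R :=
  fun l => if l == i then v else s l.

Definition basis_vec (i : 'I_n) : 'rV[R]_n := delta_mx ord0 i.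

Lemma nnker_box a b : nnker (\1_(@box R n a b)).
Proof.
by split=> [|x]; [apply: measurable_indic; exact: measurable_box|by rewrite indicE ler0n].
Qed.
#[local] Hint Resolve nnker_box : core.

Lemma corr_ker_translate k b f x : nnker k -> nnmeas f ->
  corr (fun z => k (z - b)%R) f x = corr k f (b + x).
Proof.
move=> hk hf.
have hk' : nnker (fun z => k (z - b)%R).
  split=> [|z]; last exact: hk.2.
  under eq_fun do rewrite addrC.
  by apply: (measurableT_comp hk.1); exact: measurable_rV_shift.
have [m p] := nnmeas_corr_integrand x hk' hf.
rewrite /corr -(integral_leb_translate b m p); apply: eq_integral => z _.
by rewrite (addrC b z) addrK (addrC z b) (addrA x) (addrC x b).
Qed.

Lemma box_corr_split s i (p q : R) g x : nnmeas g -> (0 <= p)%R -> (0 <= q)%R ->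
  box_corr (set_coord s i (p + q)) g x =
  box_corr (set_coord s i p) g x +
  box_corr (set_coord s i q) g (p *: basis_vec i + x).
Proof.
move=> hg p0 q0; rewrite /box_corr.
rewrite -(corr_ker_translate (p *: basis_vec i)%R x (nnker_box _ _) hg).
rewrite -corr_kerD//; last first.
  split=> [|z]; last by rewrite indicE ler0n.
  have [m _] := nnker_box (fun=> 0%R) (set_coord s i q).
  under eq_fun do rewrite addrC.
  by apply: (measurableT_comp m); exact: measurable_rV_shift.
congr corr; apply/funext => z; rewrite !indicE.
have bas l : (z - p *: basis_vec i)%R ord0 l = (z ord0 l - (if l == i then p else 0))%R.
  by rewrite !mxE eqxx /=; case: eqP => _; rewrite ?mulr1 ?mulr0.
have [iz|iz] := boolP [forall l, (l != i) ==> (0 <= z ord0 l < s l)%R]; last first.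
  rewrite !memNset ?addr0//= => h; move/negP: iz; apply; apply/forallP => l; apply/implyP => li;
  have := h l; rewrite ?bas /set_coord (negbTE li) ?subr0//.
have inE v (w : 'rV[R]_n) : (forall l, l != i -> w ord0 l = z ord0 l) ->
    (w \in box (fun=> 0%R) (set_coord s i v)) = (0 <= w ord0 i < v)%R.
  move=> wz; apply/idP/idP => [/set_mem /(_ i)|wi]; first by rewrite /set_coord eqxx.
  apply/mem_set => l; rewrite /set_coord; case: eqP => [->//|/eqP li].
  by rewrite wz//; move/forallP: iz => /(_ l); rewrite li.
rewrite !inE//; last by move=> l li; rewrite bas (negbTE li) subr0.
rewrite bas eqxx subr_ge0 ltrBlDl.
case: (leP 0%R (z ord0 i)) => [z0|z0] /=.
  case: (ltP (z ord0 i) p) => zp /=; last by rewrite add0r.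
  by rewrite addr0 (lt_le_trans zp)// lerDl.
by rewrite (leNgt p) (lt_le_trans z0 p0) /= addr0.
Qed.

(** Used in two ways: [m = 2] exhibits a step as a choice between two cubes, [m = j + 2] reassembles
    tiles into one long box. *)
Lemma box_corr_mult s i (h : R) m g x : nnmeas g -> (0 <= h)%R ->
  box_corr (set_coord s i (m%:R * h)) g x =
  \sum_(b < m) box_corr (set_coord s i h) g ((b%:R * h) *: basis_vec i + x).
Proof.
move=> hg h0; elim: m => [|m ih].
  rewrite big_ord0 /box_corr /corr -[RHS](integral0 (leb R n) setT).
  apply: eq_integral => z _; rewrite indicE memNset ?mul0e// => /(_ i).
  by rewrite /set_coord eqxx mul0r => /andP[/le_lt_trans h1 /h1]; rewrite ltxx.
rewrite big_ord_recr/= -ih -natr1 mulrDl mul1r box_corr_split//.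
by rewrite mulr_ge0.
Qed.

Lemma nnmeas_iter_corr k f j : nnker k -> nnmeas f -> nnmeas (iter j (corr k) f).
Proof. by move=> hk hf; elim: j => [|j ih] //=; exact: nnmeas_corr. Qed.

(** Pascal's rule in summed form; both binomial expansions below rest on it. *)
Lemma pascal_sum (a : nat -> \bar R) j : (forall b, 0 <= a b) ->
  \sum_(b < j.+2) ('C(j.+1, b)%:R)%:E * a b =
  \sum_(b < j.+1) ('C(j, b)%:R)%:E * (a b + a b.+1).
Proof.
move=> a0.
have c0 m b : 0 <= ('C(m, b)%:R : R)%:E by rewrite lee_fin.
under [RHS]eq_bigr do rewrite ge0_muleDr//.
rewrite big_split/= big_ord_recl /= bin0.
under eq_bigr => b _ do rewrite /bump add1n binS natrD EFinD ge0_muleDl//.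
rewrite big_split/= addeA; congr (_ + _).
rewrite [in RHS]big_ord_recl/= bin0; congr (_ + _).
by rewrite big_ord_recr/= bin_small// mul0e adde0.
Qed.

(** By hypothesis [k'] acts as [k] followed by the identity plus the translation by [e].
    Translations commute with [corr k], so the binomial theorem applies. *)
Lemma iter_corr_double k k' (e : 'rV[R]_n) f j x : nnker k -> nnker k' -> nnmeas f ->
  (forall g y, nnmeas g -> corr k' g y = corr k g y + corr k g (e + y)) ->
  iter j (corr k') f x =
  \sum_(b < j.+1) ('C(j, b)%:R)%:E * iter j (corr k) f (b%:R *: e + x)%R.
Proof.
move=> hk hk' hf E; elim: j x => [|j ih] x.
  by rewrite big_ord_recl big_ord0 /= bin0 mul1e adde0 scale0r add0r.
pose a b := iter j.+1 (corr k) f (b%:R *: e + x)%R.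
rewrite (pascal_sum (a := a)); last by move=> b; exact: (nnmeas_iter_corr j.+1 hk hf).2.
rewrite iterS E; last exact: nnmeas_iter_corr.
pose F (b : 'I_j.+1) y := ('C(j, b)%:R)%:E * translate (b%:R *: e) (iter j (corr k) f) y.
have tr (b : 'I_j.+1) : nnmeas (translate (b%:R *: e) (iter j (corr k) f)).
  exact/nnmeas_translate/nnmeas_iter_corr.
have hF b : nnmeas (F b).
  have [m p] := tr b; split=> [|y]; last by rewrite mule_ge0// lee_fin.
  by apply: emeasurable_funM.
rewrite (_ : iter j (corr k') f = fun y => \sum_(b < j.+1) F b y); last first.
  by apply/funext => y; rewrite ih.
rewrite !corr_sum// -big_split/=; apply: eq_bigr => b _.
rewrite !corrZ// -ge0_muleDr//; [|exact: (nnmeas_corr hk (tr b)).2..].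
rewrite !corr_translate /a -natr1 scalerDl scale1r /=.
by rewrite -(addrA _ e) (addrC e).
Qed.

Lemma le_integral_corr_box s g x : nnmeas g -> box_corr s g x <= \int[leb R n]_z g z.
Proof.
move=> hg; have [m p] := nnmeas_corr_integrand x (nnker_box (fun=> 0%R) s) hg.
rewrite -(integral_leb_translate x hg.1 hg.2).
apply: ge0_le_integral => //; first exact: (nnmeas_translate x hg).1.
by move=> z _; rewrite -[leRHS]mul1e lee_wpmul2r ?lee_fin ?indicE ?lern1 ?leq_b1//; exact: hg.2.
Qed.

Lemma integral_iter_corr k f j (V : R) : nnker k -> nnmeas f ->
  \int[leb R n]_z (k z)%:E = V%:E ->
  \int[leb R n]_x iter j (corr k) f x = (V ^+ j)%:E * \int[leb R n]_x f x.
Proof.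
move=> hk hf kV; elim: j => [|j ih]; first by rewrite mul1e.
rewrite iterS integral_corr//; last exact: nnmeas_iter_corr.
by rewrite kV ih muleA exprS EFinM.
Qed.

(** Goes from the cube of side [h] at [d = 0] to that of side [m h] at [d = n], so that coordinates
    are treated one at a time. *)
Definition partial_box (h : R) (d m : nat) : 'I_n -> R :=
  fun l => if (l < d)%N then (m%:R * h)%R else h.

(* In each of the first [d] coordinates the [j + 1] binomial shifts are bounded
   by [M] times [j + 2] unit shifts, whose cubes of side [h] tile a side of
   length [(j + 2) h]. *)
Lemma iter_box_corr_partial (h : R) (M : R) d j f x : nnmeas f -> (0 <= h)%R ->
  (forall b, 'C(j.+1, b)%:R <= M)%R -> (d <= n)%N ->
  iter j.+1 (box_corr (partial_box h d 2)) f x <=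
  (M ^+ d)%:E * box_corr (partial_box h d j.+2) (iter j (box_corr (fun=> h)) f) x.
Proof.
move=> hf h0 hM; elim: d x => [|d ih] x dn.
  have E m : partial_box h 0 m = fun=> h by apply/funext.
  (* One of the [j + 1] factors is set apart on the right: its cubes will be tiled, while the other
     [j] only carry mass. *)
  by rewrite !E mul1e.
have M0 : (0 <= M)%R by rewrite (le_trans _ (hM 0%N)).
pose i := Ordinal dn.
have E m : partial_box h d.+1 m = set_coord (partial_box h d m) i (m%:R * h).
  apply/funext => l; rewrite /partial_box /set_coord ltnS leq_eqVlt.
  by rewrite -val_eqE /=; case: eqP.
have E1 m : set_coord (partial_box h d m) i h = partial_box h d m.
  by apply/funext => l; rewrite /set_coord /partial_box; case: eqP => // ->; rewrite ltnn.
have hG : nnmeas (iter j (box_corr (fun=> h)) f) by exact: nnmeas_iter_corr.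
rewrite {1}/box_corr (@iter_corr_double \1_(box (fun=> 0%R) (partial_box h d 2)) _ (h *: basis_vec i))//.
  rewrite [in leRHS]E box_corr_mult// E1 ge0_sume_distrr; last first.
    by move=> b _; exact: (nnmeas_corr (nnker_box _ _) hG).2.
  apply: lee_sum => b _; rewrite scalerA exprSr EFinM -muleA (muleC M%:E) muleA muleC.
  apply: lee_pmul; rewrite ?lee_fin//.
    exact: (nnmeas_iter_corr j.+1 (nnker_box _ _) hf).2.
  by apply: ih; exact: ltnW.
move=> g y hg; have := box_corr_mult (partial_box h d 2) i 2 y hg h0.
rewrite -E E1 big_ord_recl big_ord_recl big_ord0 /= => e1.
by apply: (etrans e1); rewrite adde0 mul0r scale0r add0r mul1r.
Qed.

(** Dropping the indicator of the long tiled box leaves the integral of [j] correlations with the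
    cube of side [h], each of which multiplies the mass by [h ^+ n]. *)
Lemma iter_box_corr_le (h : R) (M : R) j f x : nnmeas f -> (0 <= h)%R ->
  (forall b, 'C(j.+1, b)%:R <= M)%R ->
  iter j.+1 (box_corr (fun=> 2 * h)%R) f x <=
  (M ^+ n * (h ^+ n) ^+ j)%:E * \int[leb R n]_z f z.
Proof.
move=> hf h0 hM.
have M0 : (0 <= M)%R by rewrite (le_trans _ (hM 0%N)).
have -> : (fun=> 2 * h)%R = partial_box h n 2.
  by apply/funext => l; rewrite /partial_box ltn_ord.
apply: le_trans (iter_box_corr_partial x hf h0 hM (leqnn n)) _.
rewrite EFinM -muleA lee_wpmul2l ?lee_fin ?exprn_ge0//.
rewrite -(@integral_iter_corr \1_(box (fun=> 0%R) (fun=> h)))//.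
  by apply: le_integral_corr_box; exact: nnmeas_iter_corr.
rewrite integral_indic//; last exact: measurable_box.
rewrite setIT; apply: etrans (lebesgue_rV_box _) _ => //.
by under eq_bigr do rewrite subr0; rewrite prodr_const card_ord.
Qed.

End box_average.

(** * Binomial and Poisson means *)

Section poisson_binomial_moments.
Context {R : realType}.
Implicit Types (x r e : R).

Lemma sum_nat_shift (F : nat -> R) n m :
  \sum_(n <= i < m + n) F i = \sum_(i < m) F (i + n)%N.
Proof. by rewrite -[n in LHS]add0n big_addn addnK big_mkord. Qed.

Lemma exp_partial_sum_le x m : 0 <= x -> \sum_(k < m) x ^+ k / k`!%:R <= expR x.
Proof.
move=> x0.
have := nondecreasing_cvgn_le _ (is_cvg_series_exp_coeff x) m.
rewrite /series /= big_mkord; apply.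
apply/nondecreasing_seqP => k; rewrite /series/= big_nat_recr//= lerDl.
by rewrite divr_ge0// exprn_ge0.
Qed.

(* The weight [k! / (k + n)!] has explicit binomial and Poisson means; it
   plays the role of [(k + 1) ^- n]. *)
Definition fact_ratio (n k : nat) : R := k`!%:R / (k + n)`!%:R.

Lemma fact_ratio_ge0 n k : 0 <= fact_ratio n k.
Proof. by rewrite divr_ge0. Qed.

(** Amounts to [(k + n)! <= n! k! (k + 1)^n], by induction from [k + n + 1 <= (n + 1)(k + 1)]. *)
Lemma expn_le_fact_ratio n k : k.+1%:R ^- n <= n`!%:R * fact_ratio n k.
Proof.
have h : ((k + n)`! <= n`! * k`! * k.+1 ^ n)%N.
  elim: n => [|n ih]; first by rewrite addn0 mul1n muln1.
  rewrite addnS !factS expnS.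
  have : (k + n < n.+1 * k.+1)%N by lia.
  by move=> /leq_mul /(_ ih); rewrite !mulnA (mulnAC _ k.+1) (mulnAC _ k.+1).
rewrite /fact_ratio mulrA ler_pdivlMr ?ltr0n ?fact_gt0//.
rewrite mulrC ler_pdivrMr ?exprn_gt0//.
by rewrite -natrX -!natrM ler_nat.
Qed.

(** The weight turns ['C(k, i)] into ['C(k + n, i + n)] up to the factor [fact_ratio n k], so the
    sum is part of the expansion of [(r + e)^(k + n) = 1]. *)
Lemma binomial_fact_ratio n r e k : 0 <= r -> 0 < e -> r + e = 1 ->
  \sum_(i < k.+1) 'C(k, i)%:R * r ^+ (k - i) * (e ^+ i * fact_ratio n i)
  <= e ^- n * fact_ratio n k.
Proof.
move=> r0 e0 re.
have E (i : 'I_k.+1) : 'C(k, i)%:R * r ^+ (k - i) * (e ^+ i * fact_ratio n i) =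
    e ^- n * fact_ratio n k * (r ^+ (k + n - (i + n)) * e ^+ (i + n) *+ 'C(k + n, i + n)).
  have ik : (i <= k)%N by rewrite -ltnS.
  have h1 := bin_fact ik.
  have := @bin_fact (k + n) (i + n); rewrite leq_add2r => /(_ ik); rewrite subnDr => h2.
  have F m : m`!%:R != 0 :> R by rewrite pnatr_eq0 -lt0n fact_gt0.
  have c1 : 'C(k, i)%:R = k`!%:R / (i`!%:R * (k - i)`!%:R) :> R.
    by rewrite -h1 !natrM mulfK// mulf_neq0.
  have c2 : 'C(k + n, i + n)%:R = (k + n)`!%:R / ((i + n)`!%:R * (k - i)`!%:R) :> R.
    by rewrite -h2 !natrM mulfK// mulf_neq0.
  rewrite -[in RHS]mulr_natr c1 c2 /fact_ratio exprD.
  by field; rewrite !F/= expf_neq0// gt_eqF.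
rewrite (eq_bigr _ (fun i _ => E i)) -mulr_sumr.
rewrite -[leRHS]mulr1 ler_wpM2l ?mulr_ge0 ?invr_ge0 ?exprn_ge0 ?fact_ratio_ge0 ?(ltW e0)//.
rewrite -(expr1n _ (k + n)) -re exprDn.
rewrite -(big_mkord xpredT (fun i => r ^+ (k + n - i) * e ^+ i *+ 'C(k + n, i))).
rewrite (@big_cat_nat _ _ _ n)//=; last by lia.
rewrite -addSn sum_nat_shift lerDr sumr_ge0// => i _.
by rewrite mulrn_wge0// mulr_ge0// exprn_ge0// ltW.
Qed.

(** The weight turns [k!] into [(k + n)!], leaving part of the exponential series divided by
    [x ^+ n]. *)
Lemma poisson_fact_ratio n x m : 0 < x ->
  \sum_(k < m) x ^+ k / k`!%:R * fact_ratio n k <= x ^- n * expR x.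
Proof.
move=> x0.
have E (k : 'I_m) : x ^+ k / k`!%:R * fact_ratio n k = x ^- n * (x ^+ (k + n) / (k + n)`!%:R).
  have F p : p`!%:R != 0 :> R by rewrite pnatr_eq0 -lt0n fact_gt0.
  by rewrite /fact_ratio exprD; field; rewrite !F/= expf_neq0// gt_eqF.
rewrite (eq_bigr _ (fun i _ => E i)) -mulr_sumr.
rewrite ler_wpM2l ?invr_ge0 ?exprn_ge0 ?(ltW x0)//.
apply: le_trans (exp_partial_sum_le (m + n) (ltW x0)).
rewrite -(big_mkord xpredT (fun i => x ^+ i / i`!%:R)).
rewrite (@big_cat_nat _ _ _ n)//=; last by lia.
rewrite sum_nat_shift lerDr sumr_ge0// => i _.
by rewrite divr_ge0// exprn_ge0// ltW.
Qed.

End poisson_binomial_moments.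

(** * Decay of the random walk with Poisson many steps *)

Lemma eq_ler (R : realType) (x y : R) : x = y -> x <= y.
Proof. by move=> ->. Qed.

Section random_walk_bound.
Context {R : realType} {n : nat}.
Implicit Types (f g : 'rV[R]_n -> \bar R).
Local Open Scope ereal_scope.

Lemma iter_corrC (k1 k2 : 'rV[R]_n -> R) f j : nnker k1 -> nnker k2 -> nnmeas f ->
  iter j (corr k1) (corr k2 f) = corr k2 (iter j (corr k1) f).
Proof.
move=> h1 h2 hf; elim: j => [|j ih] //=; rewrite ih.
by apply/funext => x; apply: corrC => //; exact: nnmeas_iter_corr.
Qed.

(** Expand the power of [k1 + k2]: the factors [k1] must be gathered, since [s i] bounds the joint
    effect of [i] of them, while each factor [k2] costs its mass [r]. The extra [j] counts factors
    [k1] already gathered, as the induction requires. *)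
Lemma iter_corr_splitting_le (k1 k2 : 'rV[R]_n -> R) (r : R) (s : nat -> R) f k j x :
  nnker k1 -> nnker k2 -> nnmeas f -> (0 <= r)%R -> (forall i, 0 <= s i)%R ->
  \int[leb R n]_z (k2 z)%:E = r%:E ->
  (forall i y, iter i (corr k1) f y <= (s i)%:E) ->
  iter j (corr k1) (iter k (corr (fun z => k1 z + k2 z)%R) f) x <=
  (\sum_(i < k.+1) 'C(k, i)%:R * r ^+ (k - i) * s (i + j)%N)%:E.
Proof.
move=> h1 h2 hf r0 s0 k2r hs.
have h12 : nnker (fun z => k1 z + k2 z)%R.
  split=> [|z]; first by apply: measurable_funD; [exact: h1.1|exact: h2.1].
  by rewrite addr_ge0//; [exact: h1.2|exact: h2.2].
elim: k j x => [|k ih] j x.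
  by rewrite big_ord_recl big_ord0 /= bin0 expr0 !mul1r addr0 add0n; exact: hs.
have hg : nnmeas (iter k (corr (fun z => (k1 z + k2 z)%R)) f) by exact: nnmeas_iter_corr.
rewrite iterS iter_corrC// corr_kerD//; last exact: nnmeas_iter_corr.
have S0 j' : (0 <= \sum_(i < k.+1) 'C(k, i)%:R * r ^+ (k - i) * s (i + j')%N)%R.
  by apply: sumr_ge0 => i _; rewrite mulr_ge0// mulr_ge0// exprn_ge0.
have hg' := nnmeas_iter_corr j h1 hg.
apply: (@le_trans _ _ ((\sum_(i < k.+1) 'C(k, i)%:R * r ^+ (k - i) * s (i + j.+1)%N)%:E +
   (\sum_(i < k.+1) 'C(k, i)%:R * r ^+ (k - i) * s (i + j)%N)%:E * r%:E)).
  apply: leeD; first exact: (ih j.+1).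
  by rewrite -k2r; apply: corr_le_cst.
have := @pascal_sum R (fun b => (r ^+ (k.+1 - b) * s (b + j)%N)%:E) k.
have a0 b : 0 <= (r ^+ (k.+1 - b) * s (b + j)%N)%:E.
  by rewrite lee_fin mulr_ge0// exprn_ge0.
move=> /(_ a0) E.
rewrite -[leRHS]sumEFin (eq_bigr (fun b : 'I__ => ('C(k.+1, b)%:R)%:E *
  (r ^+ (k.+1 - b) * s (b + j)%N)%:E)); last by move=> b _; rewrite -mulrA EFinM.
rewrite E (eq_bigr (fun b : 'I__ => ('C(k, b)%:R *
  (r ^+ (k.+1 - b) * s (b + j)%N + r ^+ (k.+1 - b.+1) * s (b.+1 + j)%N))%:E)); last first.
  by move=> b _; rewrite -EFinD -EFinM.
rewrite sumEFin -EFinM -EFinD lee_fin mulr_suml -big_split/=.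
apply: ler_sum => i _; rewrite subSS addSn addnS subSn; last by rewrite -ltnS.
by rewrite exprS; apply: eq_ler; ring.
Qed.

(** The shifts by [a] add up to a single translation, invisible to bounds uniform in [x]. *)
Lemma iter_scaled_box_corr (c h : R) a f j x : (0 <= c)%R -> (0 <= h)%R -> nnmeas f ->
  iter j (corr (fun z => c * \1_(box (fun=> 0) (fun=> h)) (z - a))%R) f x =
  (c ^+ j)%:E * iter j (box_corr (fun=> h)) f (j%:R *: a + x)%R.
Proof.
move=> c0 h0 hf.
have hb := @nnker_box R n (fun=> 0%R) (fun=> h).
have hk : nnker (fun z : 'rV[R]_n => c * \1_(box (fun=> 0) (fun=> h)) z)%R.
  split=> [|z]; last by rewrite mulr_ge0// indicE ler0n.
  exact: (measurable_funM (measurable_cst c) hb.1).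
elim: j x => [|j ih] x; first by rewrite mul1e scale0r add0r.
rewrite iterS (funext ih).
have hg := nnmeas_iter_corr j hb hf.
have hg' := nnmeas_translate (j%:R *: a) hg.
rewrite (@corr_ker_translate _ _ (fun z => c * \1_(box (fun=> 0) (fun=> h)) z)%R)//; last first.
  have [m p] := hg'; split=> [|y]; last first.
    by apply: mule_ge0; [rewrite lee_fin exprn_ge0|exact: p].
  by apply: emeasurable_funM.
rewrite (@corrZ _ _ _ _ (translate (j%:R *: a)%R _)) ?exprn_ge0//.
rewrite corr_translate exprSr EFinM -muleA; congr (_ * _).
rewrite addrA -{2}[a]scale1r -scalerDl natr1 iterS.
have [m p] := nnmeas_corr_integrand (j.+1%:R *: a + x) hb hg.
by rewrite /box_corr /corr -ge0_integralZl_EFin//; apply: eq_integral => z _; rewrite EFinM muleA.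
Qed.

(* A fixed fraction of every step is uniform on a cube, so a positive fraction
   of the Poisson many steps are; their binomial smoothing gives the decay. *)
Lemma poisson_walk_sup_le (J : 'rV[R]_n -> R) (c h : R) (a : 'rV[R]_n) :
  nnker J -> \int[leb R n]_z (J z)%:E = 1 -> (0 < c)%R -> (0 < h)%R ->
  (forall z, box (fun=> 0) (fun=> 2 * h) (z - a) -> c <= J z)%R ->
  exists e K : R, [/\ (0 < e)%R, (0 < K)%R &
    forall f (M I x : R) m y, nnmeas f -> (forall z, f z <= M%:E) -> (0 <= M)%R ->
      \int[leb R n]_z f z = I%:E -> (0 < x)%R ->
      \sum_(k < m) (x ^+ k / k`!%:R)%:E * iter k (corr J) f y <=
      (expR x * (expR (- (e * x)) * M + K * I * Num.sqrt x ^- n))%:E].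
Proof.
move=> hJ J1 c0 h0 cJ.
have h20 : (0 <= 2 * h)%R by rewrite mulr_ge0// ltW.
pose kB z := (c * \1_(box (fun=> 0) (fun=> 2 * h)) (z - a))%R.
pose kH z := (J z - kB z)%R.
have hb := @nnker_box R n (fun=> 0%R) (fun=> 2 * h)%R.
have hB : nnker kB.
  split=> [|z]; last by rewrite mulr_ge0// ?ltW// indicE ler0n.
  apply: measurable_funM => //.
  under eq_fun do rewrite addrC.
  by apply: (measurableT_comp hb.1); exact: measurable_rV_shift.
have hH : nnker kH.
  split=> [|z]; first by apply: measurable_funB; [exact: hJ.1|exact: hB.1].
  rewrite subr_ge0 /kB indicE; case: (boolP (_ \in _)) => [/set_mem/cJ|_]; first by rewrite mulr1.
  by rewrite mulr0; exact: hJ.2.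
pose e := (c * (2 * h) ^+ n)%R.
have e0 : (0 < e)%R by rewrite mulr_gt0// exprn_gt0// mulr_gt0.
have intB : \int[leb R n]_z (kB z)%:E = e%:E.
  have h1 : nnmeas (cst 1 : 'rV[R]_n -> \bar R) by split=> // z; rewrite lee_fin.
  have := @iter_scaled_box_corr c (2 * h)%R a (cst 1) 1 0%R (ltW c0) h20 h1.
  rewrite /= /box_corr /corr; under eq_integral do rewrite mule1.
  move=> ->; under eq_integral do rewrite mule1.
  rewrite expr1 integral_indic//; last exact: measurable_box.
  rewrite setIT (lebesgue_rV_box (fun=> h20)) EFinM; congr (_ * _%:E).
  by under eq_bigr do rewrite subr0; rewrite prodr_const card_ord.
have intH : \int[leb R n]_z (kH z)%:E = (1 - e)%:E.
  have : \int[leb R n]_z (J z)%:E = \int[leb R n]_z ((kB z)%:E + (kH z)%:E).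
    by apply: eq_integral => z _; rewrite /kH -EFinD addrC subrK.
  rewrite J1 ge0_integralD//; last 4 first.
  - by move=> z _; rewrite lee_fin; exact: hB.2.
  - by apply/measurable_EFinP; exact: hB.1.
  - by move=> z _; rewrite lee_fin; exact: hH.2.
  - by apply/measurable_EFinP; exact: hH.1.
  rewrite intB; case: (\int[_]_z _) => [v| |]//= [v1].
  by congr EFin; lra.
have r0 : (0 <= 1 - e)%R.
  rewrite -lee_fin -intH; apply: integral_ge0 => z _.
  by rewrite lee_fin; exact: hH.2.
(* The two summands match the two terms of [amgm] below; in the first, [2 ^+ n] comes from the
   binomial bound, [n!] from [expn_le_fact_ratio] and [e ^- n] from [binomial_fact_ratio]. *)
pose K0 : R := (2 ^+ n * n`!%:R * e ^- n + 1)%R.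
exists e, (h ^- n * K0)%R; split=> //.
  rewrite mulr_gt0 ?invr_gt0 ?exprn_gt0// ltr_wpDl//.
  by rewrite !mulr_ge0// ?exprn_ge0// invr_ge0 exprn_ge0// ltW.
move=> f M I x m y hf fM M0 fI x0.
have I0 : (0 <= I)%R by rewrite -lee_fin -fI; apply: nnmeas_integral.
set th := (Num.sqrt x ^+ n)%R.
have sx0 : (0 < Num.sqrt x)%R by rewrite sqrtr_gt0.
have th0 : (0 < th)%R by rewrite exprn_gt0.
pose W := (h ^- n * I)%R.
have W0 : (0 <= W)%R by rewrite mulr_ge0// invr_ge0 exprn_ge0// ltW.
(* Here [i] counts the uniform steps; if none is taken, only the sup bound [M] is available. *)
pose s i := ((i == 0%N)%:R * M +
   e ^+ i * (W * (th * 2 ^+ n * n`!%:R) * fact_ratio n i + W * th^-1))%R.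
have C0 : (0 <= W * (th * 2 ^+ n * n`!%:R))%R.
  by rewrite mulr_ge0// mulr_ge0// mulr_ge0 ?exprn_ge0// ltW.
have t0 i : (0 <= e ^+ i * (W * (th * 2 ^+ n * n`!%:R) * fact_ratio n i + W * th^-1))%R.
  rewrite mulr_ge0 ?exprn_ge0 ?(ltW e0)// addr_ge0//.
    by rewrite mulr_ge0// fact_ratio_ge0.
  by rewrite mulr_ge0// invr_ge0 ltW.
have s0 i : (0 <= s i)%R by rewrite addr_ge0// mulr_ge0.
have hs : forall i z, iter i (corr kB) f z <= (s i)%:E.
  move=> [|i] z.
    apply: le_trans (fM z) _; rewrite lee_fin /s eqxx mul1r lerDl.
    exact: (t0 0%N).
  rewrite (iter_scaled_box_corr a i.+1 z (ltW c0) h20 hf).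
  pose Mb : R := (2 ^+ i.+1 * Num.sqrt (2 / i.+2%:R))%R.
  have hMb b : ('C(i.+1, b)%:R <= Mb)%R.
    rewrite -(@ler_pXn2r _ 2) ?nnegrE ?mulr_ge0 ?sqrtr_ge0//.
    rewrite exprMn sqr_sqrtr ?divr_ge0// mulrA ler_pdivlMr//.
    have := sqr_bin_le i.+1 b; rewrite -(ler_nat R) !natrM !natrX => /le_trans; apply.
    by apply: eq_ler; rewrite mulrC -exprM mulnC exprM (_ : (2 ^+ 2 = 4 :> R)%R)//; ring.
  apply: (@le_trans _ _ ((c ^+ i.+1)%:E * ((Mb ^+ n * (h ^+ n) ^+ i)%:E * I%:E))).
    by rewrite lee_wpmul2l ?lee_fin ?exprn_ge0 ?(ltW c0)// -fI iter_box_corr_le// ltW.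
  rewrite -!EFinM lee_fin /s /= mul0r add0r.
  set v := Num.sqrt (2 / i.+2%:R)%R in Mb hMb *.
  (* The powers of [2] in [Mb] and of [h] rebuild [e ^+ i.+1], except for one missing [h ^+ n],
     spent on the tiled factor: hence the [h ^- n] in [W]. *)
  have -> : (c ^+ i.+1 * (Mb ^+ n * (h ^+ n) ^+ i * I) = e ^+ i.+1 * (W * v ^+ n))%R.
    have hn0 : (h ^+ n != 0)%R by rewrite expf_neq0// gt_eqF.
    rewrite /Mb /e /W !exprMn (exprAC 2%R) (exprS (h ^+ n)%R).
    by field.
  rewrite ler_wpM2l ?exprn_ge0 ?(ltW e0)// -(mulrA W) -mulrDr ler_wpM2l// -!mulrA.
  have v0 : (0 <= v ^+ n)%R by rewrite exprn_ge0// sqrtr_ge0.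
  (* Replaces [(2 / (i + 2))^(n/2)] by its square, an integer power; [th = x^(n/2)] balances the two
     terms when [i] is of order [x]. *)
  have amgm : (v ^+ n <= th * (v ^+ n) ^+ 2 + th^-1)%R.
    have : (0 <= th * (v ^+ n - th^-1) ^+ 2 + v ^+ n)%R.
      by rewrite addr_ge0// mulr_ge0 ?sqr_ge0// ltW.
    rewrite (_ : (th * _ + _ = th * (v ^+ n) ^+ 2 + th^-1 - v ^+ n)%R) ?subr_ge0//.
    by field; rewrite gt_eqF.
  apply: le_trans amgm _; rewrite lerD2r ler_wpM2l ?(ltW th0)//.
  rewrite -exprM mulnC exprM sqr_sqrtr ?divr_ge0// expr_div_n.
  by rewrite ler_wpM2l ?exprn_ge0//; exact: expn_le_fact_ratio.
have JBH : J = (fun z => kB z + kH z)%R by apply/funext => z; rewrite /kH addrC subrK.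
have hA k z : iter k (corr J) f z <=
    ((1 - e) ^+ k * M + W * (th * 2 ^+ n * n`!%:R) * e ^- n * fact_ratio n k + W * th^-1)%:E.
  rewrite JBH; apply: le_trans (iter_corr_splitting_le k 0 z hB hH hf r0 s0 intH hs) _.
  rewrite lee_fin; under eq_bigr do rewrite addn0 /s mulrDr.
  rewrite big_split/= -addrA; apply: lerD.
    (* Only the term without uniform steps sees [M]. Its weight [(1 - e) ^+ k], summed against
       [x ^+ k / k!], is what produces the factor [expR (- (e * x))]. *)
    rewrite big_ord_recl /= big1 ?addr0; last by move=> i _; rewrite mul0r mulr0.
    by rewrite bin0 subn0 !mul1r.
  under eq_bigr do rewrite mulrDr mulrDr.
  rewrite big_split/=; apply: lerD.
    rewrite -[leRHS]mulrA.
    apply: le_trans (ler_wpM2l C0 (binomial_fact_ratio n k r0 e0 (subrK _ _))).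
    by rewrite mulr_sumr; apply: ler_sum => i _; apply: eq_ler; ring.
  rewrite -[leRHS]mulr1 -[X in (_ <= _ * X)%R](expr1n _ k) -[X in (X ^+ k)%R](subrK e 1%R) exprDn mulr_sumr.
  by apply: ler_sum => i _; rewrite -mulr_natl; apply: eq_ler; ring.
apply: (@le_trans _ _ (\sum_(k < m) (x ^+ k / k`!%:R * ((1 - e) ^+ k * M +
    W * (th * 2 ^+ n * n`!%:R) * e ^- n * fact_ratio n k + W * th^-1))%:E)).
  apply: lee_sum => k _; rewrite [leRHS]EFinM lee_wpmul2l ?hA// lee_fin.
  by rewrite divr_ge0// exprn_ge0// ltW.
rewrite sumEFin lee_fin; under eq_bigr do rewrite mulrDr mulrDr.
rewrite !big_split/= mulrDr -addrA; apply: lerD.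
  rewrite mulrA -expRD -[X in expR (X - _)]mul1r -mulrBl.
  rewrite (eq_bigr (fun k : 'I_m => ((1 - e) * x) ^+ k / k`!%:R * M)%R) => [|k _]; last first.
    by rewrite exprMn; ring.
  by rewrite -mulr_suml ler_wpM2r// exp_partial_sum_le// mulr_ge0// ltW.
(* Since [x ^- n] is [th ^- 2], both terms are multiples of [th^-1]. *)
rewrite (_ : expR x * _ = W * (th * 2 ^+ n * n`!%:R) * e ^- n * (x ^- n * expR x) + W * th^-1 * expR x)%R; last first.
  rewrite /W /K0 -[in x ^- n](sqr_sqrtr (ltW x0)) -exprM mulnC exprM -/th.
  by field; rewrite gt_eqF// !expf_neq0 ?gt_eqF.
have C1 : (0 <= W * (th * 2 ^+ n * n`!%:R) * e ^- n)%R.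
  by rewrite mulr_ge0// invr_ge0 exprn_ge0// ltW.
apply: lerD.
  apply: le_trans (ler_wpM2l C1 (poisson_fact_ratio n m x0)).
  by rewrite mulr_sumr; apply: ler_sum => k _; apply: eq_ler; ring.
rewrite -mulr_suml mulrC ler_wpM2l//; last exact/exp_partial_sum_le/ltW.
by rewrite mulr_ge0// invr_ge0 ltW.
Qed.

End random_walk_bound.

(** * Full measure and regularity of the flux *)

Section full_measure.
Context {R : realType}.

Lemma box_subset_ball n (x : 'rV[R]_n) e : 0 < e ->
  box (fun i => x ord0 i - e / 2) (fun i => x ord0 i + e / 2) `<=` ball x e.
Proof.
move=> e0 w Bw; split=> // i j; rewrite [i]ord1; have /andP[h1 h2] := Bw j.
by rewrite /ball/= ltr_distl; apply/andP; split; lra.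
Qed.

(** Otherwise the open complement would contain a box of positive measure. This upgrades
    almost-everywhere inequalities between continuous functions. *)
Lemma ae_closed_rV n (A : set 'rV[R]_n) :
  closed A -> {ae leb R n, forall x, A x} -> forall x, A x.
Proof.
move=> cA [N [mN N0 AN]] x; apply: contrapT => Ax.
have : nbhs x (~` A) by apply: open_nbhs_nbhs; split=> //; exact: closed_openC.
move=> /nbhs_ballP[e /= e0 eA].
pose B := box (fun i => x ord0 i - e / 2) (fun i => x ord0 i + e / 2).
have : (leb R n B <= leb R n N)%E.
  apply: le_measure; rewrite ?inE//; first exact: measurable_box.
  by apply: subset_trans AN; apply: subset_trans eA; exact: box_subset_ball.
have hB := @lebesgue_rV_box R n (fun i => x ord0 i - e / 2) (fun i => x ord0 i + e / 2).
rewrite N0 [X in (X <= _)%E]hB => [|i]; last by lra.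
rewrite lee_fin leNgt prodr_gt0// => i _; lra.
Qed.

Lemma closed_le_continuous (T : topologicalType) (f g : T -> R) :
  continuous f -> continuous g -> closed [set x | f x <= g x].
Proof.
move=> cf cg.
rewrite (_ : [set x | _] = (fun x => g x - f x) @^-1` [set y | 0 <= y]); last first.
  by apply/seteqP; split=> x /=; rewrite subr_ge0.
apply: preimage_closed => [x _|]; last exact: closed_ge.
by apply: continuousB; [exact: cg|exact: cf].
Qed.

Lemma closed_forall_rat (A : set R) : closed A -> (forall q : rat, A (ratr q)) -> forall s, A s.
Proof.
move=> cA qA s; apply: contrapT => As.
have [|y [Ay [q _ qy]]] := @dense_rat R (~` A) _ (closed_openC cA); first by exists s.
by apply: Ay; rewrite -qy.
Qed.

Lemma ae_forall_rat d (T : measurableType d) (mu : {measure set T -> \bar R})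
    (P : rat -> T -> Prop) :
  (forall q, {ae mu, forall x, P q x}) -> {ae mu, forall x, forall q, P q x}.
Proof.
move=> hP.
have : {ae mu, forall x, forall k : nat, if unpickle k is Some q then P q x else True}.
  apply: ae_foralln => k; case: unpickle => [q|]; first exact: hP.
  exact: aeW.
by apply: filterS => x h q; have := h (pickle q); rewrite pickleK.
Qed.

(** What is kept of the hypotheses on [G] at one good point [x], for [H s = G x s * s]. *)
Record regular_flux (beta L : R) (H : R -> R) : Prop := {
  flux_lipschitz : forall s s', `|H s - H s'| <= L * `|s - s'| ;
  flux_upper : forall s, H s <= beta * s ;
  flux_sign : forall s, 0 <= H s * s ;
  flux_at0 : H 0 = 0 }.

(** Restricting to rational [s] leaves countably many null sets; continuity of [G x] then restores
    all real [s]. The upper bound [a2] on the positive difference quotients serves as [L]. *)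
Lemma regular_flux_ae n (G : 'rV[R]_n -> R -> R) (beta : R) :
  conductivity_hyp G ->
  (forall s : R, {ae lebesgue_rV R n, forall x, G x s * s <= beta * s}) ->
  exists L : R, 0 < L /\
    {ae leb R n, forall x, regular_flux beta L (fun s => G x s * s)}.
Proof.
move=> [G0 [_ cG] [a1 [a2 [a10 a12 hG]]]] hb.
exists a2; split; first exact: lt_le_trans a12.
have e1 : {ae leb R n, forall x, forall q : rat, G x (ratr q) * ratr q <= beta * ratr q}.
  by apply: ae_forall_rat => q; exact: hb.
have e2 : {ae leb R n, forall x, forall q q' : rat,
    `|G x (ratr q) * ratr q - G x (ratr q') * ratr q'| <= a2 * `|ratr q - ratr q'|}.
  apply: ae_forall_rat => q; apply: ae_forall_rat => q'.
  have [->|qq'] := eqVneq q q'; first by apply: aeW => x; rewrite !subrr normr0 mulr0.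
  have rq : ratr q != ratr q' :> R by rewrite fmorph_eq.
  have := hG _ _ rq; apply: filterS => x /andP[h1 h2].
  rewrite -ler_pdivrMr ?normr_gt0 ?subr_eq0// -normrV ?unitfE ?subr_eq0// -normrM.
  by rewrite ger0_norm// (le_trans _ h1)// ltW.
have cG' : {ae leb R n, forall x, continuous (G x)} by exact: cG.
move: cG' e1 e2; apply: filterS3 => x cx h1 h2.
pose H s := G x s * s.
have cH : continuous H by move=> s; apply: continuousM; [exact: cx|].
have cdist s' : continuous (fun s : R => a2 * `|s - s'|).
  move=> s; apply: cvgM; first exact: cvg_cst.
  by apply: cvg_norm; apply: cvgB; [exact: cvg_id|exact: cvg_cst].
have cHd s' : continuous (fun s => `|H s - H s'|).
  by move=> s; apply: cvg_norm; apply: cvgB; [exact: cH|exact: cvg_cst].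
split.
- have lip1 (q : rat) s : `|H s - H (ratr q)| <= a2 * `|s - ratr q|.
    move: s; apply: closed_forall_rat => [|q']; last exact: h2.
    exact: closed_le_continuous.
  move=> s s'; move: s'; apply: (closed_forall_rat (A := [set s' | _ <= _])) => [|q]; last exact: lip1.
  under eq_set do rewrite (distrC (H s)) (distrC s).
  exact: closed_le_continuous.
- apply: closed_forall_rat => [|q]; last exact: h1.
  by apply: closed_le_continuous => // s; apply: cvgM; [exact: cvg_cst|exact: cvg_id].
- by move=> s; rewrite -mulrA mulr_ge0// -expr2 sqr_ge0.
- by rewrite mulr0.
Qed.

End full_measure.

(** * The nonlocal operator *)

Section nonlocal_flux.
Context {R : realType} {n : nat}.
Variables (J : 'rV[R]_n.+1 -> R) (hJ : kernel_hyp J).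
Implicit Types (x y : 'rV[R]_n.+1) (w : 'rV[R]_n.+1 -> R) (H : R -> R).
Local Notation mu := (leb R n.+1).

Lemma kernel_sym x y : J (x - y) = J (y - x).
Proof.
apply: (kernel_radial hJ); congr Num.sqrt; apply: eq_bigr => i _.
by rewrite !mxE; ring.
Qed.

Lemma continuous_reflect x : continuous (fun y => x - y).
Proof.
by move=> y; apply: (@continuousB R _ _ (fun=> x) id); [exact: cst_continuous|exact: cvg_id].
Qed.

Lemma continuous_addc w (c : R) : continuous w -> continuous (fun y => w y + c).
Proof.
by move=> cw y; apply: (@continuousD R _ _ w (fun=> c));
  [exact: cw|exact: cst_continuous].
Qed.

Lemma continuous_mulc w (c : R) : continuous w -> continuous (fun y => c * w y).
Proof.
by move=> cw y; apply: (@continuousM R _ (fun=> c) w);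
  [exact: cst_continuous|exact: cw].
Qed.

Lemma nnker_kernel : nnker J.
Proof.
split; last exact: (kernel_ge0 hJ).
exact: continuous_measurable_rV (kernel_continuous hJ).
Qed.

Lemma continuous_kernel_reflect x : continuous (fun y => J (x - y)).
Proof.
move=> y; apply: continuous_comp; last exact: (kernel_continuous hJ).
exact: continuous_reflect.
Qed.

Lemma nnker_kernel_reflect x : nnker (fun y => J (x - y)).
Proof.
split=> [|y]; last exact: (kernel_ge0 hJ).
by apply: continuous_measurable_rV; exact: continuous_kernel_reflect.
Qed.

Lemma integral_kernel_reflect x (f : 'rV[R]_n.+1 -> \bar R) : nnmeas f ->
  (\int[mu]_y ((J (x - y))%:E * f y) = corr J f x)%E.
Proof.
move=> hf; rewrite /corr.
have [m p] := nnmeas_kerM (nnker_kernel_reflect x) hf.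
rewrite -(integral_leb_translate x m p); apply: eq_integral => z _.
by rewrite opprD addrA subrr sub0r -(sub0r z) kernel_sym subr0.
Qed.

Lemma integral_kernel_reflect1 x : (\int[mu]_y (J (x - y))%:E = 1)%E.
Proof.
have h1 : nnmeas (cst 1%E : 'rV[R]_n.+1 -> \bar R) by split=> // z; rewrite lee_fin.
transitivity (\int[mu]_y ((J (x - y))%:E * cst 1 y))%E.
  by apply: eq_integral => y _; rewrite /= mule1.
apply: etrans (integral_kernel_reflect x h1) _; apply: etrans _ (kernel_mass hJ).
by apply: eq_integral => y _; rewrite mule1.
Qed.

Lemma integrable_kernel_reflect x : mu.-integrable setT (EFin \o (fun y => J (x - y))).
Proof.
apply/integrableP; split; first by apply/measurable_EFinP; exact: (nnker_kernel_reflect x).1.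
rewrite (eq_integral (fun y => (J (x - y))%:E)) => [|y _]; last first.
  by rewrite /= ger0_norm ?(kernel_ge0 hJ).
by rewrite integral_kernel_reflect1 ltry.
Qed.

(** Although [w] may be unbounded, the compact support of [J] confines it to a compact set. *)
Lemma integrable_kernelM x w : continuous w ->
  mu.-integrable setT (EFin \o (fun y => J (x - y) * w y)).
Proof.
move=> cw.
have [K hK] : exists K : R, forall y, `|J (x - y) * w y| <= K * J (x - y).
  have : bounded_set ((fun z => w (x - z)) @` closure [set z | J z != 0]).
    apply: compact_bounded; apply: continuous_compact; last exact: (kernel_supp hJ).
    apply: continuous_subspaceT => z; apply: continuous_comp; last exact: cw.
    exact: continuous_reflect.
  case=> M [_ hM]; exists (M + 1) => y.
  have [Jy|Jy] := eqVneq (J (x - y)) 0; first by rewrite Jy mul0r mulr0 normr0.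
  rewrite normrM mulrC (ger0_norm (kernel_ge0 hJ _)) ler_wpM2r ?(kernel_ge0 hJ)//.
  apply: (hM (M + 1)); first by rewrite ltrDl.
  exists (x - y); last by rewrite subKr.
  exact: subset_closure.
apply: (@le_integrable _ _ _ mu _ _ _ (EFin \o (fun y => K * J (x - y)))) => //.
- apply/measurable_EFinP; apply: measurable_funM; first exact: (nnker_kernel_reflect x).1.
  exact: continuous_measurable_rV.
- by move=> y _; rewrite /= lee_fin (le_trans (hK y))// ler_norm.
- by apply: (integrableZl measurableT K (integrable_kernel_reflect x)).
Qed.

Definition inner_flux H w x : R := \int[mu]_y (J (x - y) * H (w y - w x)).

Definition kernel_mean w x : R := \int[mu]_y (J (x - y) * w y).

Lemma kernel_mean_cst x (c : R) : \int[mu]_y (J (x - y) * c) = c.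
Proof.
rewrite RintegralZr ?integrable_kernel_reflect// /Rintegral.
by rewrite integral_kernel_reflect1 /= mul1r.
Qed.

Lemma le_kernel_mean x w w' : continuous w -> continuous w' ->
  (forall y, w y <= w' y) -> kernel_mean w x <= kernel_mean w' x.
Proof.
move=> cw cw' ww'; apply: le_Rintegral; rewrite ?integrable_kernelM// => y _.
by rewrite ler_wpM2l ?(kernel_ge0 hJ).
Qed.

Section flux.
Variables (beta L : R) (H : R -> R) (hH : regular_flux beta L H) (L0 : 0 < L).

Lemma continuous_flux : continuous H.
Proof.
move=> s; apply/cvgrPdist_lt => e e0; near=> t.
rewrite (le_lt_trans (flux_lipschitz hH _ _))// mulrC -ltr_pdivlMr//.
by near: t; apply: cvgr_dist_lt => //; rewrite divr_gt0.
Unshelve. all: by end_near. Qed.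

Lemma continuous_flux_increment w x : continuous w -> continuous (fun y => H (w y - w x)).
Proof.
move=> cw y; apply: (@continuous_comp _ _ _ (fun y => w y - w x)); last exact: continuous_flux.
exact: continuous_addc.
Qed.

(** The increment changes both at [y] and at [x], whence [d + d]. Continuity of the flux in time
    follows. *)
Lemma inner_flux_lipschitz w w' x (d : R) : continuous w -> continuous w' ->
  (forall y, `|w y - w' y| <= d) -> `|inner_flux H w x - inner_flux H w' x| <= L * (d + d).
Proof.
move=> cw cw' ww'.
have cf := @continuous_flux_increment w x cw.
have cf' := @continuous_flux_increment w' x cw'.
have key y : `|H (w y - w x) - H (w' y - w' x)| <= L * (d + d).
  rewrite (le_trans (flux_lipschitz hH _ _))// ler_wpM2l ?(ltW L0)//.
  rewrite (_ : _ - _ = (w y - w' y) + (w' x - w x)); last by ring.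
  by rewrite (le_trans (ler_normD _ _))// lerD// distrC.
have cb (c : R) : continuous (fun _ : 'rV[R]_n.+1 => c) by exact: cst_continuous.
rewrite ler_distl; apply/andP; split.
  rewrite -(kernel_mean_cst x (L * (d + d))) -RintegralB ?integrable_kernelM//.
  apply: le_Rintegral => // [||y _]; rewrite ?integrable_kernelM//.
    apply: eq_integrable (integrable_kernelM x (w := fun y => H (w' y - w' x) - L * (d + d)) _) => //.
      by move=> y _; rewrite /= mulrBr.
    exact: continuous_addc.
  rewrite -mulrBr ler_wpM2l ?(kernel_ge0 hJ)//.
  by have := key y; rewrite ler_distl => /andP[].
rewrite -(kernel_mean_cst x (L * (d + d))) -RintegralD ?integrable_kernelM//.
apply: le_Rintegral => // [||y _]; rewrite ?integrable_kernelM//.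
  apply: eq_integrable (integrable_kernelM x (w := fun y => H (w' y - w' x) + L * (d + d)) _) => //.
    by move=> y _; rewrite /= mulrDr.
  exact: continuous_addc.
rewrite -mulrDr ler_wpM2l ?(kernel_ge0 hJ)//.
by have := key y; rewrite ler_distl => /andP[].
Qed.

Lemma inner_flux_le w x : continuous w ->
  inner_flux H w x <= beta * (kernel_mean w x - w x).
Proof.
move=> cw; have cf := @continuous_flux_increment w x cw.
have cb (c : R) : continuous (fun _ : 'rV[R]_n.+1 => c) by exact: cst_continuous.
have cl : continuous (fun y => beta * (w y - w x)).
  by apply: continuous_mulc; exact: continuous_addc.
apply: (@le_trans _ _ (kernel_mean (fun y => beta * (w y - w x)) x)).
  by apply: le_kernel_mean => // y; exact: (flux_upper hH).
rewrite -[in leRHS](kernel_mean_cst x (w x)) /kernel_mean -RintegralB ?integrable_kernelM//.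
rewrite -RintegralZl//.
  by apply: eq_ler; apply: eq_Rintegral => y _; ring.
apply: eq_integrable (integrable_kernelM x (w := fun y => w y - w x) _) => //.
  by move=> y _; rewrite /= mulrBr.
exact: continuous_addc.
Qed.

(** Upward increments contribute nonnegatively by the sign of [H]; a downward one is at least
    [- (m + w x)], and [H] is Lipschitz with [H 0 = 0]. *)
Lemma inner_flux_ge w x (m : R) : continuous w -> (forall y, - m <= w y) ->
  - (L * (m + w x)) <= inner_flux H w x.
Proof.
move=> cw mw; have cf := @continuous_flux_increment w x cw.
rewrite -[leLHS](kernel_mean_cst x); apply: le_kernel_mean => //[|y]; first exact: cst_continuous.
have mx : 0 <= m + w x by rewrite -lerBlDl sub0r.
have [s0|s0] := leP 0 (w y - w x).
  apply: (@le_trans _ _ 0); first by rewrite oppr_le0 mulr_ge0// ltW.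
  move: s0; rewrite le_eqVlt => /predU1P[<-|s0]; first by rewrite (flux_at0 hH).
  by have := flux_sign hH (w y - w x); rewrite pmulr_lge0.
have := flux_lipschitz hH (w y - w x) 0; rewrite (flux_at0 hH) !subr0.
rewrite ler_norml => /andP[+ _]; apply: le_trans.
rewrite lerN2 ler_wpM2l ?(ltW L0)// ltr0_norm//.
by have := mw y; lra.
Qed.

End flux.

End nonlocal_flux.

(** * Regularity in time *)

Section time_regularity.
Context {R : realType} {n : nat}.
Variable (u : R -> 'rV[R]_n.+1 -> R).

Lemma evolution_near : continuous_evolution u -> forall t e, 0 <= t -> 0 < e ->
  exists2 d : R, 0 < d & forall s, 0 <= s -> `|s - t| < d -> forall y, `|u s y - u t y| < e.
Proof.
move=> [_ cu] t e t0 e0.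
have /subspace_continuousP/(_ t t0) h := cu.
have : nbhs (u t : {uniform 'rV[R]_n.+1 -> R}) [set g | forall y, `|g y - u t y| < e].
  apply/uniform_nbhs; exists [set p : R * R | ball p.1 e p.2]; split.
    by rewrite -entourage_ballE; exists e.
  by move=> g hg y; have := hg y I; rewrite /ball/= distrC.
move=> /h; rewrite /= nbhs_simpl /within/= => /nbhs_ballP[d /= d0 hd].
by exists d => // s s0 st y; apply: hd => //; rewrite /ball/= distrC.
Qed.

(** Compactness of [[0, T]] gives one [d] such that profiles at times closer than [d] differ by at
    most [1]; steps of length [d / 2] are then chained from time [0]. *)
Lemma evolution_bounded (T : R) : continuous_evolution u -> 0 <= T ->
  exists M : R, forall t, 0 <= t <= T -> forall y, `|u t y - u 0 y| <= M.
Proof.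
move=> cu T0.
pose P (d t : R) := 0 <= t -> forall s, 0 <= s -> `|s - t| < d -> forall y, `|u s y - u t y| <= 1.
have [d d0 hd] : exists2 d, 0 < d & forall t, 0 <= t <= T -> P d t.
  have /compact_near_coveringP := @segment_compact R 0 T.
  move=> /(_ R (0^'+) P _) hc.
  have hc' : \forall d \near 0^'+, `[0, T]%classic `<=` P d.
    apply: hc => t /=; rewrite in_itv/= => /andP[t0 tT].
    have half0 : 0 < 2^-1 :> R by rewrite invr_gt0.
    have [d d0 hd] := evolution_near cu t0 half0.
    near=> t' d' => /= t'0 s s0 st' y.
    have tt' : `|t' - t| < d / 2.
      by rewrite distrC; near: t'; apply: nbhsx_ballx; rewrite divr_gt0.
    have dd : d' < d / 2 by near: d'; apply: nbhs_right_lt; rewrite divr_gt0.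
    have st : `|s - t| < d.
      rewrite -(subrKA t') (le_lt_trans (ler_normD _ _))//; lra.
    have h1 := hd s s0 st y.
    have h2 : `|u t' y - u t y| < 2^-1 by apply: hd => //; lra.
    rewrite -(subrKA (u t y)) (le_trans (ler_normD _ _))// (distrC (u t y)); lra.
  near (0 : R)^'+ => d; exists d; first by near: d; exact: nbhs_right_gt.
  have hd : `[0, T]%classic `<=` P d by near: d.
  by move=> t tT; apply: hd; rewrite /= in_itv.
have step k t : 0 <= t <= T -> t <= k%:R * (d / 2) -> forall y, `|u t y - u 0 y| <= k%:R.
  elim: k t => [|k ih] t /andP[t0 tT] tk y.
    rewrite mul0r in tk; have -> : t = 0 by apply/eqP; rewrite eq_le tk.
    by rewrite subrr normr0.
  have [td|td] := leP t (d / 2).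
    rewrite (le_trans (hd 0 _ _ t t0 _ y))// ?lexx ?T0// ?ler1n//.
    by rewrite subr0 ger0_norm//; lra.
  have h1 : `|u (t - d / 2) y - u 0 y| <= k%:R.
    apply: ih; first by lra.
    by rewrite -natr1 in tk; lra.
  have h2 : `|u t y - u (t - d / 2) y| <= 1.
    apply: hd => //; try lra.
    by rewrite subKr gtr0_norm; lra.
  rewrite -(subrKA (u (t - d / 2) y)) (le_trans (ler_normD _ _))// -natr1; lra.
exists (Num.truncn (T / (d / 2))).+1%:R => t tT; apply: step => //.
have /andP[_ tT'] := tT; rewrite (le_trans tT')// -ler_pdivrMr ?divr_gt0//.
exact/ltW/truncnS_gt.
Unshelve. all: by end_near. Qed.

End time_regularity.

(** * The integral equation at one good point *)

Section trajectory.
Context {R : realType} {n : nat}.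
Variables (J : 'rV[R]_n.+1 -> R) (hJ : kernel_hyp J).
Variables (G : 'rV[R]_n.+1 -> R -> R) (u0 : 'rV[R]_n.+1 -> R) (u : R -> 'rV[R]_n.+1 -> R).
Hypothesis hu : cauchy_solution J G u0 u.
Variables (x : 'rV[R]_n.+1) (beta L : R) (L0 : 0 < L).
Hypothesis hH : regular_flux beta L (fun s => G x s * s).
Local Notation F := (fun t => inner_flux J (fun s => G x s * s) (u t) x).

Lemma solution_continuous (t : R) : 0 <= t -> continuous (u t).
Proof. by move: hu => [[cu _] _] t0; exact: cu. Qed.

Lemma solution_integral (t : R) : 0 < t ->
  u t x = \int[@lebesgue_measure R]_(s in `[0, t]) F s + u0 x.
Proof.
move=> t0.
apply: (etrans (hu.2 x t t0)).
apply: (congr1 (fun z => z + u0 x)).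
apply: eq_Rintegral => s _.
rewrite /inner_flux.
apply: eq_Rintegral => y _.
by rewrite /increment; ring.
Qed.

Lemma flux_near (t e : R) : 0 <= t -> 0 < e ->
  exists2 d : R, 0 < d & forall s, 0 <= s -> `|s - t| < d -> `|F s - F t| <= e.
Proof.
move=> t0 e0; have e'0 : 0 < e / (L + L) by rewrite divr_gt0// addr_gt0.
have [d d0 hd] := evolution_near hu.1 t0 e'0.
exists d => // s s0 st.
apply: le_trans (inner_flux_lipschitz hJ hH L0 x (d := e / (L + L)) _ _ _) _.
- exact: solution_continuous.
- exact: solution_continuous.
- by move=> y; exact/ltW/hd.
- by apply: eq_ler; field; rewrite gt_eqF// addr_gt0.
Qed.

Lemma flux_within_continuous (T : R) : {within `[0, T], continuous F}.
Proof.
apply/subspace_continuousP => t /=; rewrite in_itv/= => /andP[t0 _].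
apply/cvgrPdist_le => e e0; have [d d0 hd] := flux_near t0 e0.
rewrite near_withinE; near=> s => /=; rewrite in_itv/= => /andP[s0 _].
have st : `|s - t| < d by rewrite distrC; near: s; exact: nbhsx_ballx.
by rewrite distrC; exact: hd.
Unshelve. all: by end_near. Qed.

Lemma flux_integrable (T : R) : (@lebesgue_measure R).-integrable `[0, T] (EFin \o F).
Proof.
apply: continuous_compact_integrable; first exact: segment_compact.
exact: flux_within_continuous.
Qed.

Lemma trajectory_is_derive (t : R) : 0 < t -> is_derive t 1 (fun s => u s x) (F t).
Proof.
move=> t0.
have ct : {for t, continuous F}.
  apply/cvgrPdist_le => e e0; have [d d0 hd] := flux_near (ltW t0) e0.
  near=> s; have s0 : 0 < s by near: s; exact: lt_nbhsr.
  have st : `|s - t| < d by rewrite distrC; near: s; apply/nbhs_ballP; exists d.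
  by rewrite distrC; apply: hd => //; exact: ltW.
have tt1 : t < t + 1 by rewrite ltrDl.
have [dF F'] := @continuous_FTC1_closed R F 0 t (t + 1) tt1 (flux_integrable (t + 1)) t0 ct.
pose U s := \int[@lebesgue_measure R]_(r in `[0, s]) F r + u0 x.
apply: (@near_eq_is_derive R R^o R^o U (fun s => u s x) t 1 (F t)).
- near=> s; rewrite solution_integral//; near: s; exact: lt_nbhsr.
- have G' : is_derive t 1 (fun s => \int[@lebesgue_measure R]_(r in `[0, s]) F r) (F t).
    by apply: DeriveDef; [exact: dF|exact: (etrans (esym (derive1E _ _)) F')].
  rewrite -[F t]addr0; exact: is_deriveD.
Unshelve. all: by end_near. Qed.

(** The integral equation is given for [t > 0] only, so the two values are compared as right limits
    at [0]. *)
Lemma trajectory_initial : u 0 x = u0 x.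
Proof.
have h : u t x @[t --> 0^'+] --> u 0 x.
  apply/cvgrPdist_lt => e e0; have [d d0 hd] := evolution_near hu.1 (lexx 0) e0.
  near=> t; have t0 : 0 <= t by near: t; exact: nbhs_right_ge.
  have td : t < d by near: t; exact: nbhs_right_lt.
  by rewrite distrC; apply: hd => //; rewrite subr0 ger0_norm.
have h' : u t x @[t --> 0^'+] --> u0 x.
  have h1 := @parameterized_integral_cvg_left R 0 1 F ltr01 (flux_integrable 1).
  have h2 : \int[@lebesgue_measure R]_(s in `[0, t]) F s + u0 x @[t --> 0^'+] --> u0 x.
    rewrite -[X in _ --> X]add0r; apply: cvgD; last exact: cvg_cst.
    exact: cvg_at_right_filter h1.
  apply: cvg_trans h2; apply: near_eq_cvg; near=> t.
  rewrite -solution_integral//; near: t; exact: nbhs_right_gt.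
exact: (cvg_unique _ h h').
Unshelve. all: by end_near. Qed.

End trajectory.

(** * One-variable calculus along trajectories *)

Lemma is_derive_ge0_ge {R : realType} (g g' : R -> R) (T : R) :
  {within `[0, T], continuous g} ->
  (forall t : R, 0 < t -> is_derive t 1 g (g' t)) ->
  (forall t : R, 0 < t <= T -> 0 <= g' t) -> forall t : R, 0 <= t <= T -> g 0 <= g t.
Proof.
move=> cg dg g'0 t /andP[t0 tT].
apply: (@ger0_derive1_le_cc _ g 0 T) => //.
- by move=> s; rewrite in_itv/= => /andP[s0 _]; have [] := dg s s0.
- move=> s; rewrite in_itv/= => /andP[s0 sT]; rewrite derive1E.
  by have [_ ->] := dg s s0; apply: g'0; rewrite s0 ltW.
- by rewrite in_itv/= lexx (le_trans t0).
- by rewrite in_itv/= t0.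
Qed.

Lemma within_continuous_trajectory {R : realType} {n : nat} (u : R -> 'rV[R]_n.+1 -> R) x (T : R) :
  continuous_evolution u -> {within `[0, T], continuous (fun s => u s x)}.
Proof.
move=> cu; apply/subspace_continuousP => t /=; rewrite in_itv/= => /andP[t0 _].
apply/cvgrPdist_lt => e e0; have [d d0 hd] := evolution_near cu t0 e0.
rewrite near_withinE; near=> s => /=; rewrite in_itv/= => /andP[s0 _].
have st : `|s - t| < d by rewrite distrC; near: s; exact: nbhsx_ballx.
by rewrite distrC; exact: hd.
Unshelve. all: by end_near. Qed.

Lemma within_continuousD_fun {R : realType} (A : set R) (f g : R -> R) :
  {within A, continuous f} -> {within A, continuous g} ->
  {within A, continuous (fun x => f x + g x)}.
Proof. by move=> cf cg x; apply: cvgD; [exact: cf|exact: cg]. Qed.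

Lemma within_continuousM_fun {R : realType} (A : set R) (f g : R -> R) :
  {within A, continuous f} -> {within A, continuous g} ->
  {within A, continuous (fun x => f x * g x)}.
Proof. by move=> cf cg x; apply: cvgM; [exact: cf|exact: cg]. Qed.

Lemma continuous_expR_scale {R : realType} (c : R) : continuous (fun s : R => expR (c * s)).
Proof.
move=> s; apply: (@continuous_comp _ _ _ (fun s => c * s) expR); last exact: continuous_expR.
by apply: (@continuousM R _ (fun=> c) id); [exact: cst_continuous|exact: cvg_id].
Qed.

Lemma is_derive_expR_scale {R : realType} (c t : R) :
  is_derive t 1 (fun s : R => expR (c * s)) (c * expR (c * t)).
Proof.
have d1 : is_derive t 1 (fun s : R => c * s) (c *: 1) by exact: is_deriveZ.
rewrite mulrC -[X in _ * X]mulr1.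
exact: (@is_derive1_comp R expR (fun s => c * s) t _ _ (is_derive_expR _) d1).
Qed.

(** Differentiation shifts the coefficients by one; when [b k] is the [k]-th iterate of [J] on [u0],
    the shift is one more correlation with [J]. *)
Lemma is_derive_exp_sum {R : realType} (c : R) (b : nat -> R) m (t : R) :
  is_derive t 1 (fun s : R => \sum_(k < m.+1) (c * s) ^+ k / k`!%:R * b k)
    (c * \sum_(k < m) (c * t) ^+ k / k`!%:R * b k.+1).
Proof.
elim: m => [|m ih].
  rewrite big_ord0 mulr0.
  rewrite (_ : (fun s : R => _) = cst (b 0%N)); first exact: is_derive_cst.
  by apply/funext => s; rewrite big_ord_recl big_ord0 /= expr0 divr1 mul1r addr0.
rewrite big_ord_recr/= mulrDr.
rewrite (_ : (fun s : R => _) = (fun s => \sum_(k < m.+1) (c * s) ^+ k / k`!%:R * b k) +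
   (fun s => (c ^+ m.+1 / m.+1`!%:R * b m.+1) *: s ^+ m.+1)); last first.
  apply/funext => s; rewrite big_ord_recr/=; congr (_ + _).
  by rewrite /GRing.scale/= exprMn; ring.
apply: is_deriveD.
have dX : is_derive t 1 (fun s : R => s ^+ m.+1) (m.+1%:R * t ^+ m).
  apply: DeriveDef; first exact: exprn_derivable.
  by rewrite exp_derive scaler1.
rewrite (_ : c * _ = (c ^+ m.+1 / m.+1`!%:R * b m.+1) *: (m.+1%:R * t ^+ m)).
  exact: is_deriveZ.
rewrite /GRing.scale/= exprMn factS natrM exprS.
have f1 : m`!%:R != 0 :> R by rewrite pnatr_eq0 -lt0n fact_gt0.
have f2 : m.+1%:R != 0 :> R by rewrite pnatr_eq0.
move: (m`!%:R : R) (m.+1%:R : R) f1 f2 => p q f1 f2.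
by field; rewrite f1.
Qed.

(** * Nonnegativity of solutions *)

Section comparison.
Context {R : realType} {n : nat}.
Variables (J : 'rV[R]_n.+1 -> R) (hJ : kernel_hyp J).
Variables (G : 'rV[R]_n.+1 -> R -> R) (beta : R) (b0 : 0 < beta).
Hypothesis hG : conductivity_hyp G.
Hypothesis hGb : forall s : R, {ae lebesgue_rV R n.+1, forall x, G x s * s <= beta * s}.
Variables (u0 : 'rV[R]_n.+1 -> R) (u : R -> 'rV[R]_n.+1 -> R).
Hypothesis u0_ge0 : forall x, 0 <= u0 x.
Hypothesis u0_cont : continuous u0.
Hypothesis hu : cauchy_solution J G u0 u.
Local Notation mu := (leb R n.+1).
Local Notation F x := (fun t => inner_flux J (fun s => G x s * s) (u t) x).

Lemma solution_initial x : u 0 x = u0 x.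
Proof.
have [L [L0 gx]] := regular_flux_ae hG hGb.
have c0 : continuous (u 0) by exact: (solution_continuous hu (lexx 0)).
have h : {ae mu, forall x, u 0 x = u0 x}.
  by move: gx; apply: filterS => y hy; exact: (trajectory_initial hJ hu L0 hy).
apply/eqP; rewrite eq_le; apply/andP; split.
  apply: (ae_closed_rV (A := [set x | u 0 x <= u0 x])); first exact: closed_le_continuous.
  by move: h; apply: filterS => y /= ->.
apply: (ae_closed_rV (A := [set x | u0 x <= u 0 x])); first exact: closed_le_continuous.
by move: h; apply: filterS => y /= ->.
Qed.

(* A lower bound [- M e^(L t)] on [[0, T]] improves to half of itself. *)
Lemma solution_ge0 (t : R) x : 0 <= t -> 0 <= u t x.
Proof.
move=> T0; set T := t in T0 *.
have [L [L0 gx]] := regular_flux_ae hG hGb.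
have [M hM] := evolution_bounded hu.1 T0.
have M0 : 0 <= M.
  by apply: le_trans (hM 0 _ x); rewrite ?normr_ge0// lexx.
have key k : forall s, 0 <= s <= T -> forall y, - (M / 2 ^+ k * expR (L * s)) <= u s y.
  elim: k => [|k ih] s sT.
    move=> y; rewrite expr0 divr1.
    have := hM s sT y; rewrite ler_norml solution_initial => /andP[h1 _].
    have : M <= M * expR (L * s).
      rewrite -[leLHS]mulr1 ler_wpM2l// -expR0 ler_expR mulr_ge0 ?(ltW L0)//.
      by case/andP: sT.
    by have := u0_ge0 y; lra.
  have s0 : 0 <= s by case/andP: sT.
  apply: (ae_closed_rV (A := [set y | _ <= u s y])).
    apply: closed_le_continuous; [exact: cst_continuous|exact: (solution_continuous hu s0)].
  move: gx; apply: filterS => y hy /=.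
  set m := M / 2 ^+ k in ih.
  have m0 : 0 <= m by rewrite divr_ge0// exprn_ge0.
  have -> : M / 2 ^+ k.+1 = m / 2 by rewrite /m exprSr invfM mulrA.
  (* By [inner_flux_ge], the derivative of [e^(L r) u] is at least [- L m e^(2 L r)], which the
     derivative of the second summand cancels; [g s >= g 0 >= 0] is then the halved bound. *)
  pose g r := expR (L * r) * u r y + m / 2 * expR (2 * L * r).
  pose g' r := expR (L * r) * (F y r) + u r y * (L * expR (L * r)) +
    m / 2 * (2 * L * expR (2 * L * r)).
  have : g 0 <= g s.
    apply: (@is_derive_ge0_ge _ g g' T) => //.
    - have ce (c : R) : {within `[0, T], continuous (fun r : R => expR (c * r))}.
        by apply: continuous_subspaceT; exact: continuous_expR_scale.
      have cm : {within `[0, T], continuous (fun _ : R => m / 2)}.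
        by apply: continuous_subspaceT; exact: cst_continuous.
      have cu := @within_continuous_trajectory R n u y T hu.1.
      exact: (within_continuousD_fun (within_continuousM_fun (ce L) cu)
               (within_continuousM_fun cm (ce (2 * L)))).
    - move=> r r0; apply: is_deriveD.
        apply: is_deriveM.
          exact: is_derive_expR_scale.
        exact: (trajectory_is_derive hJ hu L0 hy r0).
      by apply: is_deriveZ; exact: is_derive_expR_scale.
    - move=> r /andP[r0 rT].
      have rT' : 0 <= r <= T by rewrite ltW.
      have := @inner_flux_ge _ _ _ hJ _ _ _ hy L0 (u r) y (m * expR (L * r))
        (solution_continuous hu (ltW r0)) (ih r rT').
      rewrite -/(F y r) => hF.
      have e0 := expR_gt0 (L * r).
      have e2 : expR (2 * L * r) = expR (L * r) * expR (L * r) by rewrite -expRD; congr expR; ring.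
      rewrite /g' e2.
      have := ler_wpM2l (ltW e0) hF.
      set E := expR _; lra.
  rewrite /g !mulr0 expR0 mul1r mulr1 solution_initial => hg.
  have e0 := expR_gt0 (L * s).
  have e2 : expR (2 * L * s) = expR (L * s) * expR (L * s) by rewrite -expRD; congr expR; ring.
  rewrite -(ler_pM2l e0) -subr_ge0.
  rewrite (_ : _ - _ = expR (L * s) * u s y + m / 2 * expR (2 * L * s)); last by rewrite e2; ring.
  apply: le_trans hg; rewrite addr_ge0 ?u0_ge0// divr_ge0//.
have lim : (fun k => - (M / 2 ^+ k * expR (L * T))) @ \oo --> 0.
  rewrite -oppr0; apply: cvgN; rewrite -[X in _ --> X](mul0r (expR (L * T))).
  apply: cvgM; last exact: cvg_cst.
  rewrite -[X in _ --> X](mulr0 M); apply: cvgM; first exact: cvg_cst.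
  under eq_fun do rewrite -exprVn.
  by apply: cvg_expr; rewrite ger0_norm ?invr_ge0// invf_lt1 ?ltr1n.
rewrite -(cvg_lim _ lim)//; apply: limr_le; first by apply/cvg_ex; exists 0.
by near=> k; apply: key; rewrite T0 lexx.
Unshelve. all: by end_near. Qed.

End comparison.

(** * Comparison with the linear equation *)

Section series_bound.
Context {R : realType} {n : nat}.
Variables (J : 'rV[R]_n.+1 -> R) (hJ : kernel_hyp J).
Variables (G : 'rV[R]_n.+1 -> R -> R) (beta : R) (b0 : 0 < beta).
Hypothesis hG : conductivity_hyp G.
Hypothesis hGb : forall s : R, {ae lebesgue_rV R n.+1, forall x, G x s * s <= beta * s}.
Variables (u0 : 'rV[R]_n.+1 -> R) (u : R -> 'rV[R]_n.+1 -> R) (M0 : R).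
Hypothesis u0_ge0 : forall x, 0 <= u0 x.
Hypothesis u0_le : forall x, u0 x <= M0.
Hypothesis u0_cont : continuous u0.
Hypothesis hu : cauchy_solution J G u0 u.
Local Notation mu := (leb R n.+1).
Local Notation F x := (fun t => inner_flux J (fun s => G x s * s) (u t) x).
Local Notation A := (corr J).

Lemma corr_funD (k : 'rV[R]_n.+1 -> R) f g x : nnker k -> nnmeas f -> nnmeas g ->
  (corr k (fun y => f y + g y) x = corr k f x + corr k g x)%E.
Proof.
move=> hk hf hg; have [mf pf] := nnmeas_corr_integrand x hk hf.
have [mg pg] := nnmeas_corr_integrand x hk hg.
rewrite /corr -ge0_integralD//; apply: eq_integral => z _.
by rewrite ge0_muleDr//; [exact: hf.2|exact: hg.2].
Qed.

Lemma nnmeasD (f g : 'rV[R]_n.+1 -> \bar R) : nnmeas f -> nnmeas g ->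
  nnmeas (fun y => f y + g y)%E.
Proof.
move=> [mf pf] [mg pg]; split=> [|y]; last exact: adde_ge0.
exact: emeasurable_funD.
Qed.

Lemma nnmeasZ (c : R) (f : 'rV[R]_n.+1 -> \bar R) : 0 <= c -> nnmeas f ->
  nnmeas (fun y => c%:E * f y)%E.
Proof.
move=> c0 [mf pf]; split=> [|y]; last by rewrite mule_ge0// lee_fin.
exact: emeasurable_funM.
Qed.

Lemma nnmeas_sum (I : Type) (s : seq I) (f : I -> 'rV[R]_n.+1 -> \bar R) :
  (forall i, nnmeas (f i)) -> nnmeas (fun y => \sum_(i <- s) f i y)%E.
Proof.
move=> hf; split=> [|y]; last by apply: sume_ge0 => i _; exact: (hf i).2.
by apply: emeasurable_sum => i; exact: (hf i).1.
Qed.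

Lemma nnmeas_EFin (w : 'rV[R]_n.+1 -> R) : continuous w -> (forall y, 0 <= w y) ->
  nnmeas (EFin \o w).
Proof.
move=> cw w0; split=> [|y]; last by rewrite lee_fin.
by apply/measurable_EFinP; exact: continuous_measurable_rV.
Qed.

Lemma corr_cst x (c : R) : 0 <= c -> (A (fun=> c%:E) x = c%:E)%E.
Proof.
move=> c0; rewrite /corr.
rewrite (eq_integral (fun z => c%:E * (J z)%:E)%E) => [|z _]; last by rewrite muleC.
rewrite ge0_integralZl_EFin//; last 2 first.
- by move=> z _; rewrite lee_fin (kernel_ge0 hJ).
- by apply/measurable_EFinP; exact: (nnker_kernel hJ).1.
by rewrite [X in (_ * X)%E](kernel_mass hJ) mule1.
Qed.

(** In the form with [J (x - y)] the functions are integrated at [y] itself, so the inequality for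
    almost every [y] applies directly. *)
Lemma ae_le_corr f g x : nnmeas f -> nnmeas g -> {ae mu, forall y, (f y <= g y)%E} ->
  (A f x <= A g x)%E.
Proof.
move=> hf hg fg; rewrite -!(integral_kernel_reflect hJ)//.
have [mf pf] := nnmeas_kerM (nnker_kernel_reflect hJ x) hf.
have [mg pg] := nnmeas_kerM (nnker_kernel_reflect hJ x) hg.
apply: ae_ge0_le_integral => //.
move: fg; apply: filterS => y fgy _.
by rewrite lee_wpmul2l// lee_fin (kernel_ge0 hJ).
Qed.

Lemma kernel_meanE (w : 'rV[R]_n.+1 -> R) x : continuous w -> (forall y, 0 <= w y) ->
  (kernel_mean J w x)%:E = A (EFin \o w) x.
Proof.
move=> cw w0; rewrite -(integral_kernel_reflect hJ) ?nnmeas_EFin//; last exact: nnmeas_EFin.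
rewrite /kernel_mean /Rintegral fineK//.
exact: (integrable_fin_num measurableT (integrable_kernelM hJ x cw)).
Qed.

Let f0 : 'rV[R]_n.+1 -> \bar R := EFin \o u0.

Let hf0 : nnmeas f0.
Proof. exact: nnmeas_EFin. Qed.

Let hA k : nnmeas (iter k A f0).
Proof. by apply: nnmeas_iter_corr => //; exact: nnker_kernel. Qed.

Lemma iter_corr_le k x : (iter k A f0 x <= M0%:E)%E.
Proof.
have M00 : 0 <= M0 by rewrite (le_trans (u0_ge0 x)).
elim: k x => [|k ih] x; first by rewrite lee_fin.
have := corr_le_cst x (nnker_kernel hJ) (hA k) M00 ih.
by rewrite [X in (_ * X)%E](kernel_mass hJ) mule1.
Qed.

Definition iterate k x : R := fine (iter k A f0 x).

Lemma iterateE k x : (iterate k x)%:E = iter k A f0 x.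
Proof.
rewrite fineK// ge0_fin_numE; last exact: (hA k).2.
by rewrite (le_lt_trans (iter_corr_le k x))// ltry.
Qed.

(** The derivative of [e^(beta t) u] is at most [beta e^(beta t)] times the [J]-mean of [u].
    Inserting the bound of order [m] and integrating in time gives order [m + 1]; the remainder
    keeps its constant [M] because averaging with [J] fixes constants. *)
Lemma solution_le_partial_sum (T M : R) m : 0 <= T -> 0 <= M ->
  (forall t, 0 <= t <= T -> forall y, expR (beta * t) * u t y <= M) ->
  forall t, 0 <= t <= T -> {ae mu, forall x,
    ((expR (beta * t) * u t x)%:E <=
      \sum_(k < m) ((beta * t) ^+ k / k`!%:R)%:E * iter k A f0 x +
      ((beta * t) ^+ m / m`!%:R * M)%:E)%E}.
Proof.
move=> T0 MM hM; elim: m => [|m ih] t tT.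
  by apply: aeW => x; rewrite big_ord0 add0e expr0 divr1 mul1r lee_fin; exact: hM.
have [L [L0 gx]] := regular_flux_ae hG hGb.
move: gx; apply: filterS => x hx.
(* Coefficients of the bound of order [m + 1]: the iterates up to [m], then the remainder
   constant. *)
pose b k := if (k <= m)%N then iterate k x else M.
pose S (s : R) := \sum_(k < m.+2) (beta * s) ^+ k / k`!%:R * b k.
pose S' (s : R) := \sum_(k < m.+1) (beta * s) ^+ k / k`!%:R * b k.+1.
(* The induction hypothesis enters through [mean_le], which with [inner_flux_le] makes [g]
   nondecreasing; moreover [g 0 = 0]. *)
pose g s := S s + - 1 * (expR (beta * s) * u s x).
pose g' s := beta * S' s + -1 * (expR (beta * s) * F x s + u s x * (beta * expR (beta * s))).
have cu s : 0 <= s -> continuous (u s) by move=> s0; exact: (solution_continuous hu s0).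
have u_ge0 s y : 0 <= s -> 0 <= u s y by move=> s0; exact: (solution_ge0 hJ hG hGb u0_ge0 u0_cont hu).
have bt s : 0 <= s -> 0 <= beta * s by move=> ?; rewrite mulr_ge0// ltW.
have coef s k : 0 <= s -> 0 <= (beta * s) ^+ k / k`!%:R.
  by move=> s0; rewrite divr_ge0// exprn_ge0// bt.
have hb0 : b 0%N = u0 x by [].
have mean_le s : 0 <= s <= T -> expR (beta * s) * kernel_mean J (u s) x <= S' s.
  move=> sT; have s0 : 0 <= s by case/andP: sT.
  rewrite -lee_fin EFinM kernel_meanE//; [|exact: cu|by move=> y; exact: u_ge0].
  have hus : nnmeas (EFin \o u s) by apply: nnmeas_EFin; [exact: cu|move=> y; exact: u_ge0].
  rewrite -corrZ ?expR_ge0//; last exact: nnker_kernel.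
  pose P (k : 'I_m) y := (((beta * s) ^+ k / k`!%:R)%:E * iter k A f0 y)%E.
  have hP k : nnmeas (P k) by apply: nnmeasZ; [exact: coef|exact: hA].
  have hc : nnmeas (fun _ : 'rV[R]_n.+1 => ((beta * s) ^+ m / m`!%:R * M)%:E).
    by split=> // y; rewrite lee_fin mulr_ge0// coef.
  apply: (@le_trans _ _ (A (fun y => \sum_(k < m) P k y + ((beta * s) ^+ m / m`!%:R * M)%:E)%E x)).
    apply: ae_le_corr; [by apply: nnmeasZ => //; exact: expR_ge0|by apply: nnmeasD => //; exact: nnmeas_sum|].
    by move: (ih s sT); apply: filterS => y; rewrite EFinM.
  rewrite corr_funD//; [|exact: nnker_kernel|exact: nnmeas_sum].
  have hc0 : 0 <= (beta * s) ^+ m / m`!%:R * M by rewrite mulr_ge0// coef.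
  rewrite (corr_cst x hc0) (corr_sum _ x (nnker_kernel hJ) hP).
  rewrite /S' big_ord_recr/= {2}/b ltnn EFinD leeD2r//.
  rewrite -sumEFin lee_sum// => k _.
  rewrite corrZ ?coef//; last exact: nnker_kernel.
  by rewrite /b ltn_ord [leRHS]EFinM iterateE.
have g0 : g 0 <= g t.
  apply: (@is_derive_ge0_ge _ g g' T) => //.
  - have cS : {within `[0, T], continuous S}.
      apply: continuous_subspaceT => s.
      apply: differentiable_continuous; apply/derivable1_diffP.
      by have [] := is_derive_exp_sum beta b m.+1 s.
    have ce : {within `[0, T], continuous (fun r : R => expR (beta * r))}.
      by apply: continuous_subspaceT; exact: continuous_expR_scale.
    have cm : {within `[0, T], continuous (fun _ : R => - 1 : R)}.
      by apply: continuous_subspaceT; exact: cst_continuous.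
    have cu' := @within_continuous_trajectory R n u x T hu.1.
    exact: (within_continuousD_fun cS (within_continuousM_fun cm (within_continuousM_fun ce cu'))).
  - move=> s s0.
    have d1 := is_derive_exp_sum beta b m.+1 s.
    have d2 := trajectory_is_derive hJ hu L0 hx s0.
    have d3 := is_derive_expR_scale beta s.
    exact: (is_deriveD d1 (is_deriveZ (-1) (is_deriveM d3 d2))).
  - move=> s /andP[s0 sT].
    have s0' := ltW s0.
    have h1 := inner_flux_le hJ hx L0 x (cu s s0').
    have h2 : 0 <= s <= T by rewrite s0'.
    have h3 := mean_le s h2.
    have e0 := expR_gt0 (beta * s).
    have h4 := ler_wpM2l (ltW e0) h1.
    have h5 := ler_wpM2l (ltW b0) h3.
    rewrite /g'; move: h4 h5; move: (S' s) (F x s) (kernel_mean _ _ _) (u s x) (expR _) => p q r v E.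
    lra.
have S0 : S 0 = u0 x.
  rewrite /S big_ord_recl big1 => [|k _]; last by rewrite mulr0 expr0n /= !mul0r.
  by rewrite expr0 divr1 mul1r addr0.
move: g0; rewrite /g S0 mulr0 expR0 mul1r (solution_initial hJ hG hGb u0_cont hu) mulN1r subrr.
rewrite mulN1r subr_ge0 -lee_fin => /le_trans; apply.
rewrite /S big_ord_recr/= {2}/b ltnn EFinD leeD2r//.
rewrite -sumEFin lee_sum// => k _.
by rewrite /b -ltnS ltn_ord [leLHS]EFinM iterateE.
Qed.

End series_bound.

(** Pointwise [w^q <= B^(q - 1) w]; integrate and take the [q]-th root. *)
Lemma Lnorm_le_interpolation {R : realType} d (T : measurableType d)
    (mu : {measure set T -> \bar R}) (w : T -> R) (B I q : R) :
  measurable_fun setT w -> (forall x, 0 <= w x) -> (forall x, w x <= B) ->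
  (\int[mu]_x (w x)%:E <= I%:E)%E -> 0 <= B -> 0 <= I -> 1 <= q ->
  ('N[mu]_q%:E[EFin \o w] <= (B `^ (1 - q^-1) * I `^ q^-1)%:E)%E.
Proof.
move=> mw w0 wB wI B0 I0 q1.
have q0 : 0 < q by rewrite (lt_le_trans ltr01).
have le1 : (\int[mu]_x `|(EFin \o w) x| `^ q <= (B `^ (q - 1) * I)%:E)%E.
  apply: (@le_trans _ _ (\int[mu]_x ((B `^ (q - 1))%:E * (w x)%:E))%E).
    apply: ge0_le_integral => //.
    - by move=> x _; exact: poweR_ge0.
    - apply: (measurableT_comp (measurable_poweR _)); apply: measurableT_comp => //.
      exact/measurable_EFinP.
    - by apply: emeasurable_funM => //; exact/measurable_EFinP.
    move=> x _; rewrite /= ger0_norm// lee_fin.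
    have [->|wx] := eqVneq (w x) 0; first by rewrite powR0 ?gt_eqF// mulr0.
    have -> : w x `^ q = w x `^ (q - 1) * w x.
      have := @powRD _ (w x) (q - 1) 1; rewrite wx implybT subrK powRr1//.
      by apply.
    by rewrite ler_wpM2r// ge0_ler_powR ?subr_ge0// nnegrE.
  rewrite ge0_integralZl_EFin ?powR_ge0//; last 2 first.
  - by move=> x _; rewrite lee_fin.
  - exact/measurable_EFinP.
  by rewrite EFinM lee_wpmul2l// lee_fin powR_ge0.
rewrite unlock /Lnorm.
have q'0 : 0 <= q^-1 by rewrite invr_ge0 ltW.
apply: le_trans (gt0_ler_poweR q'0 _ _ le1) _.
- by rewrite in_itv/= leey andbT integral_ge0// => x _; exact: poweR_ge0.
- by rewrite in_itv/= leey andbT lee_fin mulr_ge0// powR_ge0.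
by rewrite poweR_EFin lee_fin powRM ?powR_ge0// -powRrM mulrBl mulfV ?gt_eqF// mul1r.
Qed.

(** * Letting the order of the partial sums grow *)

Section solution_bounds.
Context {R : realType} {n : nat}.
Variables (J : 'rV[R]_n.+1 -> R) (hJ : kernel_hyp J).
Variables (G : 'rV[R]_n.+1 -> R -> R) (beta : R) (b0 : 0 < beta).
Hypothesis hG : conductivity_hyp G.
Hypothesis hGb : forall s : R, {ae lebesgue_rV R n.+1, forall x, G x s * s <= beta * s}.
Variables (u0 : 'rV[R]_n.+1 -> R) (u : R -> 'rV[R]_n.+1 -> R) (M0 I0 : R).
Hypothesis u0_ge0 : forall x, 0 <= u0 x.
Hypothesis u0_le : forall x, u0 x <= M0.
Hypothesis u0_cont : continuous u0.
Hypothesis hu : cauchy_solution J G u0 u.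
Local Notation mu := (leb R n.+1).
Hypothesis u0_int : (\int[mu]_x (u0 x)%:E = I0%:E)%E.
Local Notation A := (corr J).
Let f0 : 'rV[R]_n.+1 -> \bar R := EFin \o u0.
Let c (t : R) k : R := (beta * t) ^+ k / k`!%:R.

Let hA k : nnmeas (iter k A f0).
Proof.
by apply: nnmeas_iter_corr; [exact: nnker_kernel|exact: nnmeas_EFin].
Qed.

Let c_ge0 t k : 0 <= t -> 0 <= c t k.
Proof. by move=> t0; rewrite divr_ge0// exprn_ge0// mulr_ge0// ltW. Qed.

Lemma solution_le_partial_sum_ae (t : R) : 0 <= t ->
  exists2 M : R, 0 <= M & {ae mu, forall x, forall m : nat,
    ((expR (beta * t) * u t x)%:E <=
      \sum_(k < m) (c t k)%:E * iter k A f0 x + (c t m * M)%:E)%E}.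
Proof.
move=> t0; have [M1 hM1] := evolution_bounded hu.1 t0.
have M00 : 0 <= M0 := le_trans (u0_ge0 0) (u0_le 0).
have M10 : 0 <= M1 by apply: le_trans (hM1 0 _ 0); rewrite ?normr_ge0// lexx.
exists (expR (beta * t) * (M0 + M1)); first by rewrite mulr_ge0 ?expR_ge0// addr_ge0.
apply: ae_foralln => m.
apply: (solution_le_partial_sum hJ b0 hG hGb u0_ge0 u0_le u0_cont hu m (T := t)) => //.
- by rewrite mulr_ge0 ?expR_ge0// addr_ge0.
- move=> s st y; have /andP[s0 s1] := st.
  rewrite ler_pM ?expR_ge0 ?ler_expR ?ler_wpM2l ?(ltW b0)//.
    exact: (solution_ge0 hJ hG hGb u0_ge0 u0_cont hu).
  have := hM1 s st y; rewrite (solution_initial hJ hG hGb u0_cont hu) ler_norml.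
  by move=> /andP[_]; have := u0_le y; lra.
- by rewrite t0 lexx.
Qed.

Let le_of_remainder (t M : R) (z y : \bar R) : 
  (forall m, (z <= y + (c t m * M)%:E)%E) -> (z <= y)%E.
Proof.
move=> h; apply/lee_addgt0Pr => e e0.
have : c t m * M @[m --> \oo] --> 0.
  rewrite -(mul0r M); apply: cvgM; last exact: cvg_cst.
  exact: (cvg_exp_coeff (beta * t)).
move=> /cvgrPdist_lt /(_ e e0) [m _ /(_ m (leqnn m))].
rewrite sub0r normrN => /ltW hm; apply: le_trans (h m) _.
by rewrite leeD2l// lee_fin (le_trans (ler_norm _)).
Qed.

Lemma solution_le_sup (t B : R) : 0 <= t ->
  (forall m x, (\sum_(k < m) (c t k)%:E * iter k A f0 x <= (expR (beta * t) * B)%:E)%E) ->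
  forall x, u t x <= B.
Proof.
move=> t0 hB; have [M MM hM] := solution_le_partial_sum_ae t0.
apply: (ae_closed_rV (A := [set x | u t x <= B])).
  by apply: closed_le_continuous; [exact: (solution_continuous hu t0)|exact: cst_continuous].
move: hM; apply: filterS => x hx /=.
rewrite -(ler_pM2l (expR_gt0 (beta * t))) -lee_fin.
by apply: (@le_of_remainder t M) => m; rewrite (le_trans (hx m))// leeD2r.
Qed.

(** Every iterate has integral [I0], and the partial sums of the weights stay below [e^(beta t)].
    The remainder is constant in [x], hence of infinite integral, so it is removed pointwise before
    integrating the full series term by term. *)
Lemma solution_L1_le (t : R) : 0 <= t -> (\int[mu]_x (u t x)%:E <= I0%:E)%E.
Proof.
move=> t0; have [M MM hM] := solution_le_partial_sum_ae t0.
have I00 : 0 <= I0.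
  by rewrite -lee_fin -u0_int integral_ge0// => x _; rewrite lee_fin.
have hu1 : nnmeas (EFin \o u t).
  apply: nnmeas_EFin; first exact: (solution_continuous hu t0).
  by move=> y; exact: (solution_ge0 hJ hG hGb u0_ge0 u0_cont hu).
have hP k : nnmeas (fun x => (c t k)%:E * iter k A f0 x)%E.
  by apply: nnmeasZ; [exact: c_ge0|exact: hA].
pose S x := (\sum_(k <oo) (c t k)%:E * iter k A f0 x)%E.
have e0 := expR_gt0 (beta * t).
rewrite -(@lee_pmul2l _ (expR (beta * t))%:E)//.
rewrite -ge0_integralZl_EFin ?expR_ge0//; [|by move=> x _; exact: hu1.2|exact: hu1.1].
apply: (@le_trans _ _ (\int[mu]_x S x)%E).
  apply: ae_ge0_le_integral => //.
  - by move=> x _; rewrite mule_ge0 ?lee_fin ?expR_ge0//; exact: hu1.2.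
  - by apply: emeasurable_funM => //; exact: hu1.1.
  - by move=> x _; apply: nneseries_ge0 => k _ _; exact: (hP k).2.
  - by apply: ge0_emeasurable_sum => [k x _ _|k _]; [exact: (hP k).2|exact: (hP k).1].
  move: hM; apply: filterS => x hx _.
  apply: (@le_of_remainder t M) => m; rewrite -EFinM (le_trans (hx m))// leeD2r//.
  rewrite -(big_mkord xpredT (fun k => (c t k)%:E * iter k A f0 x)%E).
  by apply: nneseries_lim_ge => k _ _; exact: (hP k).2.
rewrite /S integral_nneseries//; last 2 first.
- by move=> k; exact: (hP k).1.
- by move=> k x _; exact: (hP k).2.
have E k : (\int[mu]_x ((c t k)%:E * iter k A f0 x) = (c t k * I0)%:E)%E.
  rewrite ge0_integralZl_EFin ?c_ge0//; [|by move=> x _; exact: (hA k).2|exact: (hA k).1].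
  rewrite (@integral_iter_corr _ _ J _ k 1 (nnker_kernel hJ)) ?expr1n ?mul1e.
  - by rewrite u0_int EFinM.
  - exact: nnmeas_EFin.
  - exact: (kernel_mass hJ).
under eq_eseriesr do rewrite E.
apply: lime_le; first by apply: is_cvg_nneseries => k _ _; rewrite lee_fin mulr_ge0// c_ge0.
apply: nearW => m; rewrite big_mkord sumEFin -EFinM lee_fin -mulr_suml ler_wpM2r//.
by apply: exp_partial_sum_le; rewrite mulr_ge0// ltW.
Qed.

End solution_bounds.

(** * Decay of the norms *)

Lemma kernel_lower_box {R : realType} {n : nat} (J : 'rV[R]_n.+1 -> R) : kernel_hyp J ->
  exists (c h : R) (a : 'rV[R]_n.+1), [/\ 0 < c, 0 < h &
    forall z, box (fun=> 0) (fun=> 2 * h) (z - a) -> c <= J z].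
Proof.
move=> hJ.
have [a Ja] : exists a, 0 < J a.
  apply: contrapT => /forallNP J0; have := kernel_mass hJ.
  rewrite integral0_eq => [|z _]; first by move/eqP; rewrite eq_sym onee_eq0.
  by congr EFin; apply/eqP; rewrite eq_le (kernel_ge0 hJ) leNgt andbT; exact/negP/J0.
have J2 : 0 < J a / 2 by rewrite divr_gt0.
have /cvgrPdist_lt/(_ _ J2) /nbhs_ballP[e /= e0 he] := kernel_continuous hJ (x := a).
(* The cube has corner [a] and side [2 h = e / 2], so it fits into the sup-norm ball of radius [e],
   where [J] stays above half of [J a]. *)
exists (J a / 2), (e / 4), a; split=> //; first by rewrite divr_gt0.
move=> z hz; have : ball a e z.
  split=> // i j; rewrite [i]ord1 /ball/=.
  have := hz j; rewrite !mxE => /andP[z0 z1].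
  by rewrite distrC ger0_norm//; lra.
move=> /he /=; rewrite ltr_distl => /andP[h1 h2]; lra.
Qed.

Lemma Lfun_oo_continuous_le {R : realType} {n : nat} (f : 'rV[R]_n -> R) :
  continuous f -> f \in Lfun (lebesgue_rV R n) +oo%E -> exists M, forall x, f x <= M.
Proof.
move=> cf; rewrite inE => /andP[_]; rewrite inE /= /finite_norm unlock.
(* The norm at [+oo] is defined by cases on whether the whole space has positive measure; if it does
   not, every inequality holds almost everywhere. *)
case: ifPn => [m0|m0 _]; last first.
  exists 0; apply: (ae_closed_rV (A := [set x | f x <= 0])).
    by apply: closed_le_continuous; [exact: cf|exact: cst_continuous].
  exists setT; split=> //; apply/eqP; rewrite eq_le measure_ge0 andbT leNgt.
  exact: m0.
set s := ess_sup _ _ => soo.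
have hs : {ae leb R n, forall x, (`|(f x)%:E| <= s)%E} by exact: ess_sup_ge.
exists (fine s); apply: (ae_closed_rV (A := [set x | f x <= fine s])).
  by apply: closed_le_continuous; [exact: cf|exact: cst_continuous].
move: hs; apply: filterS => x hx /=.
rewrite -lee_fin fineK; first by rewrite (le_trans _ hx)// lee_fin ler_norm.
by rewrite fin_numElt soo andbT (lt_le_trans _ hx)// ltNyr.
Qed.

(** A positive mass of [u0] is what allows the exponentially small term to be absorbed into a
    multiple of that mass. *)
Lemma integral_gt0_continuous {R : realType} {n : nat} (f : 'rV[R]_n -> R) :
  continuous f -> (forall x, 0 < f x) -> (0 < \int[leb R n]_x (f x)%:E)%E.
Proof.
move=> cf f0; have f0' x : (0 <= (f x)%:E)%E by rewrite lee_fin ltW.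
rewrite lt0e integral_ge0// andbT; apply/eqP => I0.
have mf : measurable_fun [set: 'rV[R]_n] (EFin \o f).
  by apply/measurable_EFinP; exact: (continuous_measurable_rV cf).
have /(ae_eq_integral_abs (leb R n) measurableT mf) : (\int[leb R n]_x `|(EFin \o f) x| = 0)%E.
  by rewrite -I0; apply: eq_integral => x _; exact: (gee0_abs (f0' x)).
move=> h; have h' : {ae leb R n, forall x, f x <= 0}.
  by move: h; apply: filterS => x /(_ Logic.I) /= [->].
have := ae_closed_rV (A := [set x | f x <= 0]) (closed_le_continuous cf (@cst_continuous _ _ _)) h' 0.
by rewrite /= leNgt f0.
Qed.

(** Since [expR (e * x)] exceeds [(e * x)^(n + 1) / (n + 1)!], one power of [x] is to spare, and it
    beats the ratio of [M] to [K]. *)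
Lemma exp_decay_near {R : realType} (e M K : R) n : 0 < e -> 0 < K ->
  \forall x \near +oo, expR (- (e * x)) * M <= K * Num.sqrt x ^- n.
Proof.
move=> e0 K0.
have C0 : 0 < e ^+ n.+1 / n.+1`!%:R * K by rewrite mulr_gt0 ?divr_gt0 ?exprn_gt0 ?ltr0n ?fact_gt0.
near=> x.
have x1 : 1 <= x by near: x; apply: nbhs_pinfty_ge; exact: num_real.
have xM : `|M| / (e ^+ n.+1 / n.+1`!%:R * K) <= x by near: x; apply: nbhs_pinfty_ge; exact: num_real.
have x0 : 0 < x by lra.
have sx0 : 0 < Num.sqrt x by rewrite sqrtr_gt0.
rewrite expRN mulrC ler_pdivrMr ?expR_gt0// mulrAC ler_pdivlMr ?exprn_gt0//.
have s1 : Num.sqrt x ^+ n <= x ^+ n.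
  have sx : Num.sqrt x <= x.
    rewrite -[leRHS]sqr_sqrtr ?(ltW x0)// expr2 ler_peMr ?(ltW sx0)//.
    by rewrite -[leLHS]sqrtr1 ler_wsqrtr.
  by apply: lerXn2r; rewrite ?nnegrE ?(ltW sx0) ?(ltW x0).
apply: (@le_trans _ _ (`|M| * x ^+ n)).
  apply: le_trans (ler_wpM2l (normr_ge0 M) s1).
  by rewrite ler_wpM2r ?exprn_ge0 ?(ltW sx0)// ler_norm.
have : (e * x) ^+ n.+1 / n.+1`!%:R <= expR (e * x).
  have := expR_ge1Dxn n (mulr_ge0 (ltW e0) (ltW x0)); lra.
move=> /(ler_wpM2l (ltW K0)); apply: le_trans.
apply: (@le_trans _ _ ((x * (e ^+ n.+1 / n.+1`!%:R * K)) * x ^+ n)).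
  by rewrite ler_wpM2r ?exprn_ge0 ?(ltW x0)// -ler_pdivrMr.
by apply: eq_ler; rewrite exprMn (exprS x); ring.
Unshelve. all: by end_near. Qed.

Theorem theorem2p16 (R : realType) (n : nat) (J : 'rV[R]_n.+1 -> R)
    (hJ : kernel_hyp J) (beta : R) (hbeta : 0 < beta) (q : R) (hq : 1 <= q) :
  exists C : R, 0 < C /\
    forall (G : 'rV[R]_n.+1 -> R -> R) (hG : conductivity_hyp G)
      (hGbeta : forall s : R,
        {ae lebesgue_rV R n.+1, forall x, G x s * s <= beta * s})
      (u0 : 'rV[R]_n.+1 -> R) (u0_pos : forall x, 0 < u0 x)
      (u0_L1 : u0 \in Lfun (lebesgue_rV R n.+1) 1%E)
      (u0_Loo : u0 \in Lfun (lebesgue_rV R n.+1) +oo%E)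
      (u0_cont : continuous u0)
      (u : R -> 'rV[R]_n.+1 -> R) (hu : cauchy_solution J G u0 u),
    \forall t \near +oo,
      ('N[lebesgue_rV R n.+1]_q%:E[EFin \o u t] <=
         C%:E * 'N[lebesgue_rV R n.+1]_1[EFin \o u0] *
         (t `^ (- (n.+1%:R / 2 * (1 - q^-1))))%:E)%E.
Proof.
have [c [h [a [c0 h0 cJ]]]] := kernel_lower_box hJ.
have [e [K [e0 K0 hK]]] := poisson_walk_sup_le (nnker_kernel hJ) (kernel_mass hJ) c0 h0 cJ.
(* The [2] makes room for the exponentially small term, and [beta] comes from [Num.sqrt (beta * t)];
   [u0] and [G] have not been introduced yet. *)
pose kappa := 2 * K * Num.sqrt beta ^- n.+1.
have sb0 : 0 < Num.sqrt beta by rewrite sqrtr_gt0.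
have kappa0 : 0 < kappa by rewrite divr_gt0 ?exprn_gt0// mulr_gt0.
exists (kappa `^ (1 - q^-1)); split; first exact: powR_gt0.
move=> G hG hGb u0 u0_pos u0_L1 u0_Loo u0_cont u hu.
have u0_ge0 x : 0 <= u0 x by exact: ltW.
have [M0 u0_le] := Lfun_oo_continuous_le u0_cont u0_Loo.
have M00 : 0 <= M0 := le_trans (u0_ge0 0) (u0_le 0).
have hf0 : nnmeas (EFin \o u0) by exact: nnmeas_EFin.
have N1 : ('N[lebesgue_rV R n.+1]_1[EFin \o u0] = \int[leb R n.+1]_x (u0 x)%:E)%E.
  by rewrite Lnorm1; apply: eq_integral => x _; rewrite gee0_abs// lee_fin.
have [I hI] : exists I : R, (\int[leb R n.+1]_x (u0 x)%:E = I%:E)%E.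
  exists (fine (\int[leb R n.+1]_x (u0 x)%:E)); rewrite fineK// ge0_fin_numE.
    rewrite -N1; move: u0_L1; rewrite inE => /andP[_]; rewrite inE /=.
    exact.
  by apply: integral_ge0 => x _; rewrite lee_fin.
have I0 : 0 < I by rewrite -lte_fin -hI; exact: integral_gt0_continuous.
rewrite N1 hI.
(* This sets the threshold on [t], which depends on [u0] through [M0] and [I]. *)
have near1 : \forall t \near +oo,
    expR (- (e * (beta * t))) * M0 <= K * I * Num.sqrt (beta * t) ^- n.+1.
  have := @exp_decay_near R e M0 (K * I) n.+1 e0 (mulr_gt0 K0 I0).
  move=> [A [_ hA]]; exists (A / beta); split; first exact: num_real.
  by move=> t; rewrite ltr_pdivrMr// mulrC => /hA.
near=> t.
have t0 : 0 < t by near: t; apply: nbhs_pinfty_gt; exact: num_real.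
have decay : expR (- (e * (beta * t))) * M0 <= K * I * Num.sqrt (beta * t) ^- n.+1 by near: t.
have st0 : 0 < Num.sqrt t by rewrite sqrtr_gt0.
pose B := kappa * I * Num.sqrt t ^- n.+1.
have B0 : 0 <= B by rewrite divr_ge0 ?exprn_ge0 ?(ltW st0)// mulr_ge0// ltW.
have sup_le : forall x, u t x <= B.
  apply: (solution_le_sup hJ hbeta hG hGb u0_ge0 u0_le u0_cont hu (ltW t0)) => m x.
  have bt : 0 < beta * t by rewrite mulr_gt0.
  apply: le_trans (hK (EFin \o u0) M0 I (beta * t) m x hf0 _ M00 hI bt) _.
    by move=> z; rewrite lee_fin.
  rewrite lee_fin ler_wpM2l ?expR_ge0// (le_trans (lerD decay (lexx _)))//.
  rewrite sqrtrM ?(ltW hbeta)// /B /kappa exprMn invfM; apply: eq_ler; ring.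
have L1_le := solution_L1_le hJ hbeta hG hGb u0_ge0 u0_le u0_cont hu hI (ltW t0).
have ct : continuous (u t) by exact: (solution_continuous hu (ltW t0)).
have ut0 x : 0 <= u t x.
  exact: (solution_ge0 hJ hG hGb u0_ge0 u0_cont hu _ (ltW t0)).
apply: le_trans (Lnorm_le_interpolation (continuous_measurable_rV ct) ut0 sup_le L1_le B0 (ltW I0) hq) _.
rewrite -!EFinM lee_fin /B.
have st : Num.sqrt t ^- n.+1 = t `^ (- (n.+1%:R / 2)).
  rewrite -powR12_sqrt ?(ltW t0)// -powR_mulrn ?powR_ge0// -powRrM powRN; congr (_ `^ _)^-1.
  by rewrite mulrC.
have q0 : 0 < q by rewrite (lt_le_trans ltr01).
rewrite st !powRM ?powR_ge0 ?(ltW kappa0) ?(ltW I0) ?mulr_ge0 ?powR_ge0//; try exact: ltW.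
rewrite -powRrM mulNr -!mulrA ler_wpM2l ?powR_ge0// mulrCA mulrC mulrA mulrC.
(* The sup bound contributes the power [1 - 1/q] of the mass, the [L^1] bound the remaining
   [1/q]. *)
have II : I `^ (1 - q^-1) * I `^ q^-1 = I.
  rewrite -powRD ?subrK ?powRr1 ?(ltW I0)//.
  by rewrite (gt_eqF I0) implybT.
by rewrite -[in leRHS]II; apply: eq_ler; ring.
Unshelve. all: by end_near. Qed.
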